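(* Let $n\ge 1$ and let $D\subset\mathbb{E}^n$ be a bounded convex domain with Hilbert metric $h_D$. Then the Hilbert geometry $(D,h_D)$ is isometric to a normed vector space over $\mathbb{R}$ if and only if $D$ is the interior of a simplex.
   Context: $\mathbb{E}^n$ denotes $n$-dimensional Euclidean space, and $|xy|$ the Euclidean distance between $x,y\in\mathbb{E}^n$. A bounded convex domain is a nonempty bounded open convex subset $D\subset\mathbb{E}^n$; $\partial D$ is its boundary in $\mathbb{E}^n$. The Hilbert metric $h_D:D\times D\to[0,\infty)$ is defined by $h_D(x,x)=0$ and, for $x\neq y$ in $D$, $$h_D(x,y)=\log\frac{|y\bar{x}|\cdot|x\bar{y}|}{|x\bar{x}|\cdot|y\bar{y}|},$$ where $\bar{x},\bar{y}$ are the two intersection points of $\partial D$ with the straight line through $x$ and $y$, labelled so that $|\bar{x}x|<|\bar{x}y|$ and $|\bar{y}x|>|\bar{y}y|$. The metric space $(D,h_D)$ is called a Hilbert geometry. An $n$-simplex in $\mathbb{E}^n$ is the convex hull of $n+1$ points in general position (i.e. affinely independent), so it has nonempty interior. ''Isometric'' means that there is a surjective distance-preserving map, where a normed vector space $(V,\|\cdot\|)$ carries the metric $\|v-w\|$. *)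

(* Defs.v *)
(* Libraries: MathComp and MathComp-Analysis. *)
From HB Require Import structures.
From mathcomp Require Import all_boot all_order all_algebra.
From mathcomp Require Import all_classical all_reals all_analysis.

Set Implicit Arguments.
Unset Strict Implicit.
Unset Printing Implicit Defensive.

Import Order.TTheory GRing.Theory Num.Theory.
Import numFieldNormedType.Exports.

Local Open Scope classical_set_scope.
Local Open Scope ring_scope.

(* The norm that the library puts on ['rV[R]_n] is the sup norm. It is used
   below only through the topology and the bounded sets, which are the same as
   those of the Euclidean norm; all lengths are measured with [eucl_dist]. *)
Definition eucl_dist (R : realType) (n : nat) (x y : 'rV[R]_n) : R :=
  Num.sqrt (\sum_(i < n) (x 0 i - y 0 i) ^+ 2).

Definition bounded_convex_domain (R : realType) (n : nat)
    (D : set 'rV[R]_n) : Prop :=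
  [/\ D !=set0, open D, convex_set (D : set (convex_lmodType 'rV[R]_n))
    & bounded_set D].

Definition boundary (T : topologicalType) (A : set T) : set T :=
  closure A `\` A°.

Definition line (R : realType) (n : nat) (x y : 'rV[R]_n) : set 'rV[R]_n :=
  [set x + t *: (y - x) | t in [set: R]].

(* The intersection point of the line through x and y with the boundary of D
   that lies on the side of x; the one on the side of y is
   [line_endpoint D y x]. It exists and is unique when x and y are distinct
   points of a bounded convex domain D. *)
Definition line_endpoint (R : realType) (n : nat) (D : set 'rV[R]_n)
    (x y : 'rV[R]_n) : 'rV[R]_n :=
  get [set p | [/\ boundary D p, line x y p & eucl_dist p x < eucl_dist p y]].

(* Meaningful only for x and y in D. *)
Definition hilbert_dist (R : realType) (n : nat) (D : set 'rV[R]_n)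
    (x y : 'rV[R]_n) : R :=
  if x == y then 0 else
  let xbar := line_endpoint D x y in
  let ybar := line_endpoint D y x in
  ln ((eucl_dist y xbar * eucl_dist x ybar) / (eucl_dist x xbar * eucl_dist y ybar)).

Definition isometric_to_normed_space (R : realType) (n : nat)
    (D : set 'rV[R]_n) : Prop :=
  exists (V : normedModType R) (f : 'rV[R]_n -> V),
    f @` D = [set: V] /\
    (forall x y, D x -> D y -> `|f x - f y| = hilbert_dist D x y).

Definition convex_hull (R : realType) (n : nat) (A : set 'rV[R]_n) :
    set 'rV[R]_n :=
  smallest (@convex_set R 'rV[R]_n) A.

Definition affinely_independent (R : realType) (n m : nat)
    (p : 'I_m -> 'rV[R]_n) : Prop :=
  forall c : 'I_m -> R,
    \sum_(i < m) c i = 0 -> \sum_(i < m) c i *: p i = 0 ->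
    forall i, c i = 0.

Definition is_simplex (R : realType) (n : nat) (S : set 'rV[R]_n) : Prop :=
  exists2 p : 'I_n.+1 -> 'rV[R]_n,
    affinely_independent p & S = convex_hull (range p).

(* Main.v *)
Require Import Defs.
From HB Require Import structures.
From mathcomp Require Import all_boot all_order all_algebra.
From mathcomp Require Import all_classical all_reals all_analysis.
From mathcomp Require Import ring lra.
Import Order.TTheory GRing.Theory Num.Theory.
Import numFieldNormedType.Exports.
Local Open Scope classical_set_scope.
Local Open Scope ring_scope.

Set Implicit Arguments.
Unset Strict Implicit.
Unset Printing Implicit Defensive.

(** Straight chords are geodesics of the Hilbert metric, and
    [h(x, y) = ln (M N)] where [M] and [N] are the ratios [|x e| / |y e|] and
    [|y e'| / |x e'|] taken at the two ends [e], [e'] of the chord.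

    From a normed space to a simplex.  Let [xi] be an extreme point of
    [closure D].  A chord ending at [xi] is the only geodesic between any two of
    its points ([chord_between_extreme]): equality in the triangle inequality
    makes [xi] a convex combination of exit points of rays from [x] and [z], which
    must then coincide with [xi].  Its image in the normed space [V] is therefore
    a straight line [v0 + R u] whose segments are uniquely geodesic
    ([geodesic_line]).  Translations of [V] preserve this property, so through
    every [p] in [D] there passes a chord of [D] mapped onto [f p + R u], and it
    stays at bounded distance from the first chord.  Bounded distance near the
    boundary means having limits in a common face ([hilbert_le]).  Hence all these
    chords end at [xi] forward, and backward they end in the face of the other
    endpoint [eta] of the first chord ([parallel_chord]).  A hyperplane supporting
    [D] at [eta] contains that face, so [closure D] is a cone with apex [xi] over
    its intersection with a hyperplane ([extreme_cone]).

    This holds at every extreme point.  The affine function [phi_xi] that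
    vanishes on the base of the cone and equals [1] at [xi] vanishes at all other
    extreme points, so the extreme points are affinely independent, and writing a
    point successively as a combination of an apex and a point of its base exhibits
    [closure D] as their convex hull ([cones_simplex]).  Since [D] is open, there
    are [n + 1] of them.

    From a simplex to a normed space.  In barycentric coordinates [M] is the
    largest of the ratios [x i / y i], so [h(x, y)] is the oscillation over [i] of
    [ln (x i) - ln (y i)] ([log_coord_isometry]): the logarithms of the coordinates,
    modulo constants, map [D] isometrically onto [R^(n+1) / R] with the
    oscillation norm. *)

(** * Limits along ultrafilters *)

Lemma ultra_fmap (T T' : Type) (f : T -> T') (U : set_system T) :
  UltraFilter U -> UltraFilter (f @ U).
Proof.
move=> UU; split=> [|G GP fG]; first exact: fmap_proper_filter.
apply/seteqP; split=> [A GA|]; last exact: fG.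
case: (in_ultra_setVsetC (f @^-1` A) UU) => // UnA.
have /filter_ex [x [Ax nAx]] : G (A `&` ~` A) by apply: filterI => //; exact: fG.
by case: nAx.
Qed.

(** Along an ultrafilter every sequence of a compact set converges, so several
    limits can be taken at once without extracting subsequences. *)
Lemma compact_ultra_cvg (T : Type) (K : topologicalType) (A : set K)
    (U : set_system T) (z : T -> K) :
  UltraFilter U -> compact A -> (forall k, A (z k)) ->
  exists2 l, A l & z @ U --> l.
Proof.
move=> UU; rewrite compact_ultra => cA Az.
have [l [Al zl]] := cA _ (ultra_fmap z UU) (filterE _ Az).
by exists l.
Qed.

Section ConvexGeometry.
Context {R : realType} {n : nat}.
Implicit Types (x y z : 'rV[R]_n) (A D K : set 'rV[R]_n) (a b : R).

(** * Convex sets in coordinates *)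

Lemma convex_setP (V : lmodType R) (A : set V) :
  @convex_set R V A <->
  forall (x y : V) a b, A x -> A y -> 0 <= a -> 0 <= b -> a + b = 1 ->
    A (a *: x + b *: y).
Proof.
split=> [cA x y a b Ax Ay a0 b0 ab|cA x y l].
  have a1 : a <= 1 by rewrite -ab lerDl.
  pose l : {i01 R} := Itv01 a0 a1.
  have /(_ _ _)/set_mem := cA x y l; rewrite !inE => /(_ Ax Ay).
  rewrite /conv /= /unstable.onem.
  by have -> : 1 - a = b by rewrite -ab addrAC subrr add0r.
rewrite !inE => Ax Ay; apply: (cA x y) => //.
  by rewrite /unstable.onem subr_ge0.
by rewrite /unstable.onem addrC subrK.
Qed.

Lemma cvg_comb (T : Type) (F : set_system T) (FF : Filter F)
    (s t : T -> R) (u v : T -> 'rV[R]_n) a b x y :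
  s @ F --> a -> t @ F --> b -> u @ F --> x -> v @ F --> y ->
  (fun i => s i *: u i + t i *: v i) @ F --> a *: x + b *: y.
Proof. by move=> sa tb ux vy; apply: cvgD; apply: cvgZ. Qed.

Lemma cvg_ray (T : Type) (F : set_system T) (FF : Filter F)
    (s : T -> R) (u v w : T -> 'rV[R]_n) a x y z :
  s @ F --> a -> u @ F --> x -> v @ F --> y -> w @ F --> z ->
  (fun i => u i + s i *: (v i - w i)) @ F --> x + a *: (y - z).
Proof. by move=> sa ux vy wz; apply: cvgD => //; apply: cvgZ => //; apply: cvgB. Qed.

Lemma convex_closure A :
  @convex_set R 'rV[R]_n A -> @convex_set R 'rV[R]_n (closure A).
Proof.
move=> /convex_setP cA; apply/convex_setP => x y a b cx cy a0 b0 ab B Bn.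
have : (fun p : 'rV[R]_n * 'rV[R]_n => a *: p.1 + b *: p.2) @ (x, y)
    --> a *: x + b *: y.
  by apply: cvg_comb; [exact: cvg_cst|exact: cvg_cst|exact: cvg_fst|exact: cvg_snd].
move=> /(_ _ Bn) [[P Q] /= [Px Qy] PQ].
have [p [Ap Pp]] := cx _ Px; have [q [Aq Qq]] := cy _ Qy.
exists (a *: p + b *: q); split; first exact: cA.
exact: (PQ (p, q)).
Qed.

(** [x + s (y - y')] is close to [x] when [y'] is close to [y], so [y] may be
    replaced by a nearby point of [D] at the price of moving [x] inside [D]. *)
Lemma open_segment D x y a b :
  open D -> @convex_set R 'rV[R]_n D -> D x -> closure D y ->
  0 < a -> 0 <= b -> a + b = 1 -> D (a *: x + b *: y).
Proof.
move=> oD /convex_setP cD Dx cy a0 b0 ab.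
pose g (p : 'rV[R]_n) := x + (b / a) *: (y - p).
have : g @ y --> x + (b / a) *: (y - y).
  by apply: (@cvg_ray _ (nbhs y)); (exact: cvg_id || exact: cvg_cst).
rewrite subrr scaler0 addr0 => /(_ D (open_nbhs_nbhs (conj oD Dx))) /cy [p [Dp Dg]].
have -> : a *: x + b *: y = a *: g p + b *: p.
  apply/rowP => i; rewrite !mxE; field; exact: lt0r_neq0.
exact: cD (ltW a0) _ _.
Qed.

Lemma interior_closure D :
  bounded_convex_domain D -> (closure D)° = D.
Proof.
move=> [[p Dp] oD cD _]; apply/seteqP; split; last first.
  by apply: (subset_trans _ (interiorS (@subset_closure _ D))); rewrite (iffLR (interior_id D)).
move=> x ix.
have : (fun e : R => x + e *: (x - p)) @ (0 : R) --> x + (0 : R) *: (x - p).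
  by apply: (@cvg_ray _ (nbhs (0 : R))); (exact: cvg_id || exact: cvg_cst).
rewrite scale0r addr0 => /(_ _ ix) /nbhs_ballP[e /= e0 he].
have De : closure D (x + (e / 2) *: (x - p)).
  apply: he; rewrite /ball /= sub0r normrN gtr0_norm ?divr_gt0 //; lra.
have -> : x = (e / 2 / (1 + e / 2)) *: p + (1 / (1 + e / 2)) *: (x + (e / 2) *: (x - p)).
  by apply/rowP => i; rewrite !mxE; field; lra.
apply: open_segment => //; first by rewrite !divr_gt0 ?addr_gt0 ?divr_gt0.
  by rewrite divr_ge0 // addr_ge0 // divr_ge0 // ltW.
field; lra.
Qed.

Lemma open_line D p (v : 'rV[R]_n) : open D -> D p ->
  exists2 e : R, 0 < e & D (p + e *: v) /\ D (p - e *: v).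
Proof.
move=> oD Dp.
have c : (fun t : R => p + t *: (v - 0)) @ (0 : R) --> p + (0 : R) *: (v - 0).
  by apply: (@cvg_ray _ (nbhs (0 : R))); (exact: cvg_id || exact: cvg_cst).
rewrite scale0r addr0 subr0 in c.
have /nbhs_ballP[e /= e0 he] := c D (open_nbhs_nbhs (conj oD Dp)).
exists (e / 2); first by rewrite divr_gt0.
have e2 : 0 < e / 2 by rewrite divr_gt0.
by split; [|rewrite -scaleNr]; apply: he; rewrite /ball /= sub0r normrN ?normrN gtr0_norm //; lra.
Qed.

Lemma compact_closure_domain D :
  bounded_convex_domain D -> compact (closure D).
Proof.
move=> [_ _ _ [M [Mr DM]]]; apply: bounded_closed_compact; last exact: closed_closure.
exists M; split=> // M' MM' x cx.
have cB : closed [set y : 'rV[R]_n | `|y| <= M'].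
  exact: (iffLR (continuous_closedP _) (@norm_continuous R 'rV[R]_n) _ (@closed_le R M')).
apply: cB; apply: closureS cx => y Dy; exact: DM MM' y Dy.
Qed.

Definition extreme K x :=
  K x /\ forall y z a b, K y -> K z -> 0 < a -> 0 < b -> a + b = 1 ->
    x = a *: y + b *: z -> y = x.

Definition dot x y : R := \sum_i x 0 i * y 0 i.

Lemma dotC x y : dot x y = dot y x.
Proof. by apply: eq_bigr => i _; rewrite mulrC. Qed.

Lemma dot_comb a b x y z : dot (a *: x + b *: y) z = a * dot x z + b * dot y z.
Proof.
rewrite /dot !mulr_sumr -big_split; apply: eq_bigr => i _ /=.
by rewrite !mxE mulrDl !mulrA.
Qed.

Lemma dotBl x y z : dot (x - y) z = dot x z - dot y z.
Proof. by have := dot_comb 1 (-1) x y z; rewrite !scaleN1r scale1r mul1r mulN1r. Qed.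

Lemma dotZl a x z : dot (a *: x) z = a * dot x z.
Proof. by have := dot_comb a 0 x 0 z; rewrite !scale0r addr0 mul0r addr0. Qed.

Lemma dotBr x y z : dot z (x - y) = dot z x - dot z y.
Proof. by rewrite dotC dotBl !(dotC z). Qed.

Lemma dotZr a x z : dot z (a *: x) = a * dot z x.
Proof. by rewrite dotC dotZl dotC. Qed.

Lemma dot_ge0 x : 0 <= dot x x.
Proof. by apply: sumr_ge0 => i _; rewrite -expr2 sqr_ge0. Qed.

Lemma dot_eq0 x : dot x x = 0 -> x = 0.
Proof.
move=> /eqP; rewrite psumr_eq0 => [/allP x0|i _]; last by rewrite -expr2 sqr_ge0.
apply/rowP => i; rewrite mxE; apply/eqP.
by have := x0 i (mem_index_enum _); rewrite mulf_eq0 orbb.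
Qed.

Lemma cvg_dot (T : Type) (F : set_system T) (FF : Filter F)
    (u v : T -> 'rV[R]_n) x y :
  u @ F --> x -> v @ F --> y -> (fun i => dot (u i) (v i)) @ F --> dot x y.
Proof.
move=> ux vy.
have c (w : T -> 'rV[R]_n) (l : 'rV[R]_n) i : w @ F --> l -> (fun t => w t 0 i) @ F --> l 0 i.
  move=> wl; exact: (continuous_cvg _ (@coord_continuous R 1 n 0 i l) wl).
rewrite /dot; elim: (index_enum _) => [|i s IH].
  by under eq_fun do rewrite big_nil; rewrite big_nil; exact: cvg_cst.
under eq_fun do rewrite big_cons; rewrite big_cons.
by apply: cvgD => //; apply: cvgM; exact: c.
Qed.

(** The Euclidean norm is strictly convex, so a point of largest norm is
    extreme. *)
Lemma extreme_exists K : compact K -> K !=set0 -> exists x, extreme K x.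
Proof.
move=> cK K0.
have /(compact_EVT_max K0 cK) [x /set_mem Kx xmax] :
    {within K, continuous (fun x => dot x x)}.
  apply: continuous_subspaceT => x.
  by apply: (@cvg_dot _ (nbhs x)); exact: cvg_id.
exists x; split=> // y z a b Ky Kz a0 b0 ab xE.
have My := xmax y (mem_set Ky); have Mz := xmax z (mem_set Kz).
have E : dot x x = a * dot y y + b * dot z z - a * b * dot (y - z) (y - z).
  rewrite xE !(dot_comb, dotC _ (_ + _)) !(dotBl, dotBr) (dotC z y).
  have -> : b = 1 - a by lra.
  ring.
have H : a * b * dot (y - z) (y - z) <= 0.
  have : a * dot y y <= a * dot x x by rewrite ler_pM2l.
  have : b * dot z z <= b * dot x x by rewrite ler_pM2l.
  have : a * dot x x + b * dot x x = dot x x by rewrite -mulrDl ab mul1r.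
  lra.
have /dot_eq0/subr0_eq yz : dot (y - z) (y - z) = 0.
  apply/eqP; rewrite eq_le dot_ge0 andbT.
  by rewrite -(@pmulr_rle0 _ (a * b)) ?mulr_gt0.
by rewrite xE -yz -scalerDl ab scale1r.
Qed.

(** The point of the segment from [q] to [z] at parameter [P / (P + S)] would be
    closer to [e] than [q] if [P], the inner product below, were positive. *)
Lemma dot_nearest K e q :
  @convex_set R 'rV[R]_n K -> K q ->
  (forall z, K z -> dot (q - e) (q - e) <= dot (z - e) (z - e)) ->
  forall z, K z -> dot (z - q) (e - q) <= 0.
Proof.
move=> /convex_setP cK Kq qmin z Kz; rewrite leNgt; apply/negP => pos.
set P := dot (z - q) (e - q) in pos; set S := dot (z - q) (z - q).
have S0 : 0 <= S := dot_ge0 _.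
pose t := P / (P + S).
have PS : 0 < P + S by rewrite ltr_wpDr.
have t0 : 0 < t by rewrite divr_gt0.
have t1 : t <= 1 by rewrite ler_pdivrMr // mul1r lerDl.
have := qmin ((1 - t) *: q + t *: z).
have -> : (1 - t) *: q + t *: z - e = (q - e) + t *: (z - q).
  by apply/rowP => i; rewrite !mxE; ring.
have -> : dot (q - e + t *: (z - q)) (q - e + t *: (z - q)) =
    dot (q - e) (q - e) - 2 * t * P + t ^+ 2 * S.
  have := dot_comb 1 t (q - e) (z - q); rewrite scale1r => E.
  have -> : P = - dot (z - q) (q - e) by rewrite /P -(opprB q e) -(scaleN1r (q - e)) dotZr mulN1r.
  rewrite E dotC (dotC (z - q)) !E /S (dotC (q - e) (z - q)); ring.
move=> /(_ _)/wrap[].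
  by apply: cK => //; [lra|exact: ltW|ring].
have : t * S < 2 * P.
  have : t * (P + S) = P by rewrite /t divfK // gt_eqF.
  by have := mulr_gt0 t0 pos; lra.
move=> H; have : t * (t * S) < t * (2 * P) by rewrite ltr_pM2l.
lra.
Qed.

(** Points [e] of the ray from [p] through [x] tend to [x] from outside
    [closure D]; the vectors from their nearest points [q] in [closure D] to [e],
    scaled to norm [1], are normals, and a limit of them is normal at [x]. *)
Lemma supporting_normal D p x :
  bounded_convex_domain D -> D p -> closure D x -> ~ D x ->
  exists2 v : 'rV[R]_n, v <> 0 & forall z, closure D z -> dot (z - x) v <= 0.
Proof.
move=> bD Dp cx nDx; have [_ oD cD _] := bD.
have cptD := compact_closure_domain bD.
pose e (k : nat) : 'rV[R]_n := x + (k.+1%:R^-1 : R) *: (x - p).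
have ex_q k : exists q, closure D q /\
    forall z, closure D z -> dot (q - e k) (q - e k) <= dot (z - e k) (z - e k).
  have /(compact_EVT_min _ cptD) [|q /set_mem Kq qmin] :
      {within closure D, continuous (fun z => dot (z - e k) (z - e k))}.
  - apply: continuous_subspaceT => z.
    by apply: (@cvg_dot _ (nbhs z)); apply: cvgB; (exact: cvg_id || exact: cvg_cst).
  - by exists x.
  - by exists q; split=> // z Kz; apply: qmin; rewrite inE.
have [q qP] := choice ex_q.
have qe k : e k - q k != 0.
  apply/negP => /eqP/subr0_eq eq; apply: nDx.
  set s : R := k.+1%:R^-1.
  have s0 : 0 < s by rewrite invr_gt0 ltr0n.
  have -> : x = (s / (1 + s)) *: p + (1 / (1 + s)) *: e k.
    have -> : e k = x + s *: (x - p) by [].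
    by clearbody s; apply/rowP => i; rewrite !mxE; field; rewrite gt_eqF // addr_gt0.
  apply: open_segment => //.
  - by rewrite eq; have [] := qP k.
  - by rewrite divr_gt0 ?addr_gt0.
  - by rewrite divr_ge0 // addr_ge0 // ltW.
  - by field; rewrite gt_eqF // addr_gt0.
pose v k : 'rV[R]_n := `|e k - q k|^-1 *: (e k - q k).
have nv k : `|v k| = 1.
  by rewrite normrZ normfV normr_id mulVf // normr_eq0.
have cptS : compact [set w : 'rV[R]_n | `|w| = 1].
  apply: bounded_closed_compact.
    by exists 1; split=> // M M1 w /= ->; exact: ltW.
  exact: (iffLR (continuous_closedP _) (@norm_continuous R 'rV[R]_n) _ (@closed_eq R 1)).
have [U [UU sU]] := @ultraFilterLemma nat \oo _.
have [q' Kq' cq] := compact_ultra_cvg UU cptD (fun k => proj1 (qP k)).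
have [v' /= nv' cv] := compact_ultra_cvg UU cptS nv.
have ce : e @ U --> x.
  have : e @ \oo --> x + (0 : R) *: (x - p).
    by apply: cvg_ray; (exact: cvg_harmonic || exact: cvg_cst).
  by rewrite scale0r addr0; apply: cvg_trans; exact: cvg_app.
have le_q z : closure D z -> dot (z - q') v' <= 0.
  move=> Kz; have c : (fun k => dot (z - q k) (v k)) @ U --> dot (z - q') v'.
    by apply: cvg_dot => //; apply: cvgB => //; exact: cvg_cst.
  apply: (cvgr_to_le c); apply: nearW => k; rewrite dotZr.
  have [Kq qmin] := qP k.
  rewrite pmulr_rle0 ?invr_gt0 ?normr_gt0 //.
  exact: (dot_nearest (convex_closure cD) Kq qmin).
have ge_q : 0 <= dot (x - q') v'.
  have c : (fun k => dot (e k - q k) (v k)) @ U --> dot (x - q') v'.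
    by apply: cvg_dot => //; exact: cvgB.
  apply: (cvgr_to_ge c); apply: nearW => k; rewrite dotZr.
  by rewrite mulr_ge0 ?dot_ge0 // invr_ge0.
exists v'; first by move=> v0; move: nv'; rewrite v0 normr0 => /esym/eqP; rewrite oner_eq0.
move=> z Kz; have -> : z - x = (z - q') - (x - q') by rewrite opprB addrA subrK.
by rewrite dotBl; have := le_q z Kz; lra.
Qed.

Definition aff (w : 'rV[R]_n) (c : R) x : R := dot x w + c.

Lemma aff_comb w c x y a b : a + b = 1 ->
  aff w c (a *: x + b *: y) = a * aff w c x + b * aff w c y.
Proof.
rewrite /aff dot_comb => ab; have -> : b = 1 - a by lra.
by ring.
Qed.

Definition in_segment z x y :=
  exists a b : R, [/\ 0 <= a, 0 <= b, a + b = 1 & z = a *: x + b *: y].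

(** Four aligned points [x, p, q, y] in this order. *)
Lemma segment_trans p q x y :
  in_segment p x q -> in_segment q p y -> p <> q -> in_segment p x y.
Proof.
move=> [a [b [a0 b0 ab]]] /[swap] -[a' [b' [a0' b0' ab']]].
have [/andP[/eqP -> /eqP ->] qE _|] := boolP ((a' == 1) && (b' == 0)).
  by case; rewrite qE scale1r scale0r addr0.
rewrite negb_and => ab'n qE pE _.
have d0 : 0 < 1 - b * a'.
  move: ab'n a0 b0 ab a0' b0' ab'; clear => ab'n a0 b0 ab a0' b0' ab'.
  have : a' < 1 by move: ab'n; rewrite !neq_lt => /orP[] /orP[]; lra.
  nra.
exists (a / (1 - b * a')), (b * b' / (1 - b * a')); split.
- by rewrite divr_ge0 // ltW.
- by rewrite divr_ge0 ?mulr_ge0 // ltW.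
- move: ab ab' d0; clear => ab ab' d0.
  have -> : a = 1 - b by lra.
  have -> : b' = 1 - a' by lra.
  by field; rewrite gt_eqF.
- apply/rowP => i; have := congr1 (fun w : 'rV_n => w 0 i) pE.
  have := congr1 (fun w : 'rV_n => w 0 i) qE; rewrite !mxE => -> pE'.
  have n0 : 1 - b * a' != 0 by rewrite gt_eqF.
  by apply: (mulfI n0); rewrite mulrBl mul1r {1}pE'; field.
Qed.

Lemma segment_limit (T : Type) (U : set_system T) (p z w : T -> 'rV[R]_n) q x y :
  UltraFilter U -> p @ U --> q -> z @ U --> x -> w @ U --> y ->
  (forall k, in_segment (p k) (z k) (w k)) -> in_segment q x y.
Proof.
move=> UU pq zx wy seg.
have [a aP] := choice seg.
have [b abP] := choice aP.
have c01 : compact [set r : R | r \in `[0, 1]] by exact: segment_compact.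
have [|al al01 ca] := compact_ultra_cvg (z := a) UU c01.
  by move=> k; have [] := abP k; rewrite /= in_itv /=; lra.
move: al01; rewrite /= in_itv /= => /andP[al0 al1].
have bE : b = (fun k => 1 - a k) by apply/funext => k; have [] := abP k; lra.
have cb : b @ U --> 1 - al by rewrite bE; apply: cvgB => //; exact: cvg_cst.
exists al, (1 - al); split=> //; [lra|lra|].
have c1 : (fun k => a k *: z k + b k *: w k) @ U --> al *: x + (1 - al) *: y.
  exact: cvg_comb.
apply: (cvg_unique (F := (fun k => a k *: z k + b k *: w k) @ U) _ _ c1).
  exact: norm_hausdorff.
have -> // : (fun k => a k *: z k + b k *: w k) = p.
by apply/funext => k; have [_ _ _ ->] := abP k.
Qed.

End ConvexGeometry.

(** * Chords and the Hilbert distance *)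

Section Hilbert.
Context {R : realType} {n : nat} {D : set 'rV[R]_n}.
Hypothesis hD : bounded_convex_domain D.
Implicit Types (x y z e xi eta : 'rV[R]_n) (s t r : R).

Let D_open : open D. Proof. by case: hD. Qed.
Let D_convex : @convex_set R 'rV[R]_n D. Proof. by case: hD. Qed.
Let subD : D `<=` closure D. Proof. exact: subset_closure. Qed.

Definition frontier e := closure D e /\ ~ D e.

Lemma boundary_frontier : boundary D = frontier.
Proof. by rewrite /boundary (iffLR (interior_id D)). Qed.

(** The ray from [x] through [y] leaves [D] at [e], and [M] is the ratio
    [|x e| / |y e|]. *)
Definition exits x y (M : R) e :=
  [/\ 1 < M, frontier e & x = M *: y - (M - 1) *: e].

Lemma exits_exists x y : D x -> D y -> x != y -> exists M e, exits x y M e.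
Proof.
move=> Dx Dy xy.
pose g t := x + t *: (y - x).
have cg : continuous g.
  move=> t; apply: (@cvg_ray _ _ _ (nbhs t)); (exact: cvg_id || exact: cvg_cst).
pose T := g @^-1` closure D.
have cT : closed T := iffLR (continuous_closedP _) cg _ (@closed_closure _ D).
have d0 : 0 < `|y - x| by rewrite normr_gt0 subr_eq0 eq_sym.
have T1 : T 1 by rewrite /T /= /g scale1r addrC subrK; exact: subD.
have ubT : has_ubound T.
  have [C [_ CD]] := compact_bounded (compact_closure_domain hD).
  exists ((C + 1 + `|x|) / `|y - x|) => t Tt.
  rewrite ler_pdivlMr //; apply: (@le_trans _ _ `|t *: (y - x)|).
    by rewrite normrZ ler_wpM2r // ler_norm.
  have -> : t *: (y - x) = g t - x by rewrite /g addrAC subrr add0r.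
  apply: (le_trans (ler_normB _ _)); rewrite lerD2r.
  by apply: CD => //; rewrite ltrDl.
pose b := sup T.
have Tb : T b.
  rewrite (iffLR (closure_id T) cT); apply: closure_sup => //; by exists 1.
have nDb : ~ D (g b).
  move=> Db.
  have /cg/nbhs_ballP[r /= r0 hr] : nbhs (g b) D by exact: open_nbhs_nbhs.
  have : b + r / 2 <= b.
    apply: ub_le_sup => //; apply/subD/hr.
    by rewrite /ball /= opprD addrA subrr sub0r normrN gtr0_norm ?divr_gt0 //; lra.
  by rewrite gerDl leNgt divr_gt0.
have b1 : 1 < b.
  rewrite lt_neqAle ub_le_sup // andbT; apply/eqP => b1; apply: nDb.
  by rewrite -b1 /g scale1r addrC subrK.
exists (b / (b - 1)), (g b); split=> //.
  by rewrite ltr_pdivlMr; lra.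
by rewrite /g; apply/rowP => i; rewrite !mxE; field; lra.
Qed.

(** Beyond its exit point a ray never meets [closure D] again, and a larger ratio
    means a point closer to [y]. *)
Lemma exits_le x y M e N e' : D y -> exits x y M e ->
  1 < N -> closure D e' -> x = N *: y - (N - 1) *: e' -> M <= N.
Proof.
move=> Dy [M1 [ce nDe] xe] N1 ce' xe'; rewrite leNgt; apply/negP => NM; apply: nDe.
have -> : e = ((M - N) / (M - 1)) *: y + ((N - 1) / (M - 1)) *: e'.
  apply/rowP => i; have := congr1 (fun v : 'rV_n => v 0 i) xe; rewrite xe' !mxE => E.
  have M10 : M - 1 != 0 by lra.
  apply: (mulfI M10); move: E; set p := y 0 i; set q := e' 0 i; set u := e 0 i => E.
  have -> : (M - 1) * ((M - N) / (M - 1) * p + (N - 1) / (M - 1) * q) = (M - N) * p + (N - 1) * q.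
    by field.
  lra.
apply: open_segment => //.
- by rewrite divr_gt0 //; lra.
- by rewrite divr_ge0 //; lra.
- by field; lra.
Qed.

Lemma exits_inj x y M e N e' : D y -> exits x y M e -> exits x y N e' -> M = N /\ e = e'.
Proof.
move=> Dy xe xe'; have [M1 [ce _] xE] := xe; have [N1 [ce' _] xE'] := xe'.
have MN : M = N.
  by apply/eqP; rewrite eq_le (exits_le Dy xe N1 ce' xE') (exits_le Dy xe' M1 ce xE).
split=> //; subst N; move: xE; rewrite xE' => /addrI/oppr_inj/esym.
by apply: scalerI; rewrite subr_eq0 gt_eqF.
Qed.

Lemma exits_neq x y M e : D y -> exits x y M e -> x != y.
Proof.
move=> Dy [M1 [_ nDe] xE]; apply/eqP => xy; apply: nDe.
have -> // : e = y.
apply: (@scalerI _ _ (M - 1)); first by rewrite subr_eq0 gt_eqF.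
apply/rowP => i; have := congr1 (fun v : 'rV_n => v 0 i) xE; rewrite xy !mxE; lra.
Qed.

Lemma eucl_distE x y : eucl_dist x y = Num.sqrt (dot (x - y) (x - y)).
Proof. by congr Num.sqrt; apply: eq_bigr => i _; rewrite !mxE expr2. Qed.

Lemma eucl_dist_scale x y z e s :
  x - y = s *: (z - e) -> eucl_dist x y = `|s| * eucl_dist z e.
Proof.
move=> E; rewrite !eucl_distE E.
by rewrite dotZl dotZr mulrA -expr2 sqrtrM ?sqr_ge0 // sqrtr_sqr.
Qed.

Lemma eucl_dist_gt0 x y : x != y -> 0 < eucl_dist x y.
Proof.
move=> xy; rewrite eucl_distE sqrtr_gt0 lt_neqAle dot_ge0 andbT.
apply/negP => /eqP/esym/dot_eq0/subr0_eq E; by rewrite E eqxx in xy.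
Qed.

Lemma exits_dist x y M e : exits x y M e -> eucl_dist x e = M * eucl_dist y e.
Proof.
move=> [M1 _ ->]; rewrite (@eucl_dist_scale _ _ y e M).
  by rewrite gtr0_norm //; lra.
by apply/rowP => i; rewrite !mxE; ring.
Qed.

Lemma line_endpointE x y N e : D x -> D y -> exits y x N e -> line_endpoint D x y = e.
Proof.
move=> Dx Dy ye; have yx := exits_neq Dx ye.
have [N1 [ce nDe] yE] := ye.
have xe : x != e by apply/eqP => xe; rewrite -xe in nDe.
rewrite /line_endpoint boundary_frontier.
set P := [set p | _].
have Pe : P e.
  split=> //.
    exists (- (N - 1)^-1) => //; rewrite yE.
    by apply/rowP => i; rewrite !mxE; field; lra.
  have sym u v : eucl_dist (R:=R) (n:=n) u v = eucl_dist v u.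
    by rewrite (@eucl_dist_scale u v v u (-1)) ?normrN1 ?mul1r // scaleN1r opprB.
  rewrite (sym e x) (sym e y) (exits_dist ye).
  by rewrite -{1}(mul1r (eucl_dist x e)) ltr_pM2r // eucl_dist_gt0.
have [fp [t _ pE] pd] : P (get P) by apply: getPex; exists e.
have dxy : 0 < eucl_dist y x := eucl_dist_gt0 yx.
move: pd; rewrite (@eucl_dist_scale (get P) x y x t); last first.
  by rewrite -pE addrAC subrr add0r.
rewrite (@eucl_dist_scale (get P) y y x (t - 1)); last first.
  by rewrite -pE; apply/rowP => i; rewrite !mxE; ring.
rewrite ltr_pM2r // => tt.
have t2 : t < 1 / 2.
  rewrite ltNge; apply/negP => t2.
  by move: tt; case: (ger0P t) => ?; case: (ger0P (t - 1)) => ?; lra.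
have t0 : t < 0.
  rewrite ltNge; apply/negP => t0; case: fp => _; apply; rewrite -pE.
  have -> : x + t *: (y - x) = (1 - t) *: x + t *: y.
    by apply/rowP => i; rewrite !mxE; ring.
  by apply: (iffLR (convex_setP D) D_convex) => //; lra.
have ye' : exits y x ((1 - t) / - t) (get P).
  split=> //; first by rewrite ltr_pdivlMr; lra.
  by rewrite -pE; apply/rowP => i; rewrite !mxE; field; lra.
by have [_ <-] := exits_inj Dx ye ye'.
Qed.

(** The cross ratio that defines the distance is the product of the ratios at the
    two ends of the chord. *)
Lemma hilbertE x y M e N e' : D x -> D y -> exits x y M e -> exits y x N e' ->
  hilbert_dist D x y = ln (M * N).
Proof.
move=> Dx Dy xe ye; rewrite /hilbert_dist (negbTE (exits_neq Dy xe)).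
rewrite (line_endpointE Dx Dy ye) (line_endpointE Dy Dx xe).
rewrite (exits_dist xe) (exits_dist ye).
have [_ [_ nDe] _] := xe; have [_ [_ nDe'] _] := ye.
have : eucl_dist y e != 0 by apply/lt0r_neq0/eucl_dist_gt0/eqP => E; rewrite E in Dy.
have : eucl_dist x e' != 0 by apply/lt0r_neq0/eucl_dist_gt0/eqP => E; rewrite E in Dx.
by move=> ? ?; congr ln; field; apply/andP.
Qed.

Lemma hilbert_eq0 x y : D x -> D y -> hilbert_dist D x y = 0 -> x = y.
Proof.
move=> Dx Dy; apply: contra_eq => xy.
have [M [e xe]] := exits_exists Dx Dy xy.
have [|N [e' ye]] := exits_exists Dy Dx; first by rewrite eq_sym.
rewrite (hilbertE Dx Dy xe ye) gt_eqF // ln_gt0 //.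
by have [M1 _ _] := xe; have [N1 _ _] := ye; rewrite mulr_egt1.
Qed.

(** The segment from [x] to [y] can be prolonged inside [closure D] beyond [y] by
    a fixed proportion of its length. This survives in the limit when [x] and [y]
    go to the boundary at bounded distance, and puts their limits in a common
    face. *)
Lemma hilbert_le x y K : D x -> D y -> 1 < K -> hilbert_dist D x y <= ln K ->
  closure D (y + (K - 1)^-1 *: (y - x)).
Proof.
move=> Dx Dy K1; have [->|xy] := eqVneq x y.
  by rewrite subrr scaler0 addr0 => _; exact: subD.
have [M [e xe]] := exits_exists Dx Dy xy.
have [|N [e' ye]] := exits_exists Dy Dx; first by rewrite eq_sym.
rewrite (hilbertE Dx Dy xe ye).
have [M1 [ce _] ->] := xe; have [N1 _ _] := ye.
rewrite ler_ln ?posrE ?mulr_gt0 //; try lra.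
move=> MNK; have MK : M <= K by apply: le_trans MNK; rewrite ler_peMr //; lra.
have -> : y + (K - 1)^-1 *: (y - (M *: y - (M - 1) *: e)) =
    ((K - M) / (K - 1)) *: y + ((M - 1) / (K - 1)) *: e.
  by apply/rowP => i; rewrite !mxE; field; lra.
apply: (iffLR (convex_setP _) (convex_closure D_convex)) => //.
- exact: subD.
- by rewrite divr_ge0 //; lra.
- by rewrite divr_ge0 //; lra.
- by field; lra.
Qed.

(** ** Arc length along a chord *)

(** The chord from [eta] to [xi], parametrized by Hilbert arc length. *)
Definition chord xi eta t : 'rV[R]_n :=
  (1 + expR t)^-1 *: (expR t *: xi + eta).

Lemma chord_sym xi eta t : chord eta xi (- t) = chord xi eta t.
Proof.
have := expR_gt0 t; rewrite /chord expRN => t0.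
apply/rowP => i; rewrite !mxE; field.
by rewrite ?gt_eqF // ?addr_gt0.
Qed.

Lemma chord_in xi eta t r : closure D xi -> closure D eta ->
  D (chord xi eta t) -> D (chord xi eta r).
Proof.
have main xi' eta' t' r' : closure D xi' ->
    D (chord xi' eta' t') -> t' <= r' -> D (chord xi' eta' r').
  move=> cxi Dt; rewrite -ler_expR => tr; have t0 := expR_gt0 t'.
  have -> : chord xi' eta' r' =
      ((1 + expR t') / (1 + expR r')) *: chord xi' eta' t' +
      ((expR r' - expR t') / (1 + expR r')) *: xi'.
    by apply/rowP => i; rewrite !mxE; field; apply/andP; split; lra.
  apply: open_segment => //.
  - by rewrite divr_ge0 //; lra.
  - by field; lra.
move=> cxi ceta Dt; have [tr|/ltW rt] := lerP t r; first exact: main Dt tr.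
rewrite -chord_sym; apply: (main _ _ (- t)); rewrite ?chord_sym //.
by rewrite lerN2.
Qed.

Lemma chord_exits xi eta t r : frontier xi -> t < r ->
  exits (chord xi eta t) (chord xi eta r) ((1 + expR r) / (1 + expR t)) xi.
Proof.
move=> fxi; rewrite -ltr_expR => tr; have t0 := expR_gt0 t; split=> //.
  by rewrite ltr_pdivlMr; lra.
by apply/rowP => i; rewrite !mxE; field; apply/andP; split; lra.
Qed.

Lemma chord_exits_rev xi eta t r : frontier eta -> t < r ->
  exits (chord xi eta r) (chord xi eta t) ((1 + expR (- t)) / (1 + expR (- r))) eta.
Proof.
by move=> feta tr; rewrite -!(chord_sym xi); apply: chord_exits => //; rewrite ltrN2.
Qed.

Lemma hilbert_chord xi eta t r : frontier xi -> frontier eta ->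
  D (chord xi eta t) ->
  hilbert_dist D (chord xi eta t) (chord xi eta r) = `|r - t|.
Proof.
have main xi' eta' t' r' : frontier xi' -> frontier eta' ->
  D (chord xi' eta' t') -> t' < r' ->
  hilbert_dist D (chord xi' eta' t') (chord xi' eta' r') = `|r' - t'|.
  move=> fxi feta Dt tr.
  have Dr : D (chord xi' eta' r') by apply: chord_in Dt; [case: fxi|case: feta].
  rewrite (hilbertE Dt Dr (chord_exits eta' fxi tr) (chord_exits_rev xi' feta tr)).
  rewrite gtr0_norm ?subr_gt0 // -[RHS]expRK; congr ln.
  have t0 := expR_gt0 t'; have r0 := expR_gt0 r'.
  by rewrite expRD !expRN; field; apply/and4P; split; lra.
move=> fxi feta Dt; have [tr|rt|<-] := ltgtP t r.
- exact: main.
- rewrite -!(chord_sym xi) main ?ltrN2 ?chord_sym //.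
  by rewrite opprK addrC distrC.
- by rewrite subrr normr0 /hilbert_dist eqxx.
Qed.

Lemma chord_through x y : D x -> D y -> x != y ->
  exists xi eta t r, [/\ frontier xi, frontier eta, t < r,
    x = chord xi eta t & y = chord xi eta r].
Proof.
move=> Dx Dy xy.
have [M [xi xe]] := exits_exists Dx Dy xy.
have [|N [eta ye]] := exits_exists Dy Dx; first by rewrite eq_sym.
have [M1 fxi xE] := xe; have [N1 feta yE] := ye.
have MN1 : 1 < M * N by rewrite mulr_egt1.
have s0 : 0 < (M - 1) / (M * (N - 1)) by rewrite divr_gt0 ?mulr_gt0 //; lra.
have r0 : 0 < N * (M - 1) / (N - 1) by rewrite divr_gt0 ?mulr_gt0 //; lra.
exists xi, eta, (ln ((M - 1) / (M * (N - 1)))), (ln (N * (M - 1) / (N - 1))).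
have key i : [/\ (M * N - 1) * x 0 i = (M - 1) * xi 0 i + M * (N - 1) * eta 0 i &
    (M * N - 1) * y 0 i = N * (M - 1) * xi 0 i + (N - 1) * eta 0 i].
  have := congr1 (fun v : 'rV_n => v 0 i) xE; rewrite !mxE => Ex.
  have := congr1 (fun v : 'rV_n => v 0 i) yE; rewrite !mxE => Ey.
  split; last by rewrite Ex in Ey; move/(congr1 (fun u => - u)): Ey; lra.
  by rewrite Ey in Ex; move/(congr1 (fun u => - u)): Ex; lra.
split=> //.
- rewrite ltr_ln ?posrE //.
  rewrite ltr_pdivrMr ?mulr_gt0 //; try lra.
  have -> : N * (M - 1) / (N - 1) * (M * (N - 1)) = (M - 1) * (M * N) by field; lra.
  by rewrite ltr_pMr //; lra.
- rewrite /chord lnK ?posrE //; apply/rowP => i; have [Ex _] := key i; rewrite !mxE.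
  have n0 : M * N - 1 != 0 by lra.
  apply: (mulfI n0); rewrite Ex; field.
  by apply/and3P; split; lra.
- rewrite /chord lnK ?posrE //; apply/rowP => i; have [_ Ey] := key i; rewrite !mxE.
  have n0 : M * N - 1 != 0 by lra.
  apply: (mulfI n0); rewrite Ey; field.
  by apply/andP; split; lra.
Qed.

Lemma chord_segment xi eta t m r : t < r -> t <= m -> m <= r ->
  in_segment (chord xi eta m) (chord xi eta t) (chord xi eta r).
Proof.
rewrite -ltr_expR -(ler_expR t m) -(ler_expR m r) => tr tm mr.
have t0 := expR_gt0 t; have r0 := expR_gt0 r; have m0 := expR_gt0 m.
exists ((1 + expR t) * (expR r - expR m) / ((1 + expR m) * (expR r - expR t))).
exists ((1 + expR r) * (expR m - expR t) / ((1 + expR m) * (expR r - expR t))).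
split.
- by rewrite divr_ge0 // mulr_ge0 //; lra.
- by rewrite divr_ge0 // mulr_ge0 //; lra.
- by field; rewrite !gt_eqF //=; lra.
- by apply/rowP => i; rewrite !mxE; field; rewrite !gt_eqF //=; lra.
Qed.

Lemma chord_cvg (U : set_system nat) xi eta :
  UltraFilter U -> \oo `<=` U ->
  (fun k => chord xi eta (ln k.+2%:R)) @ U --> xi.
Proof.
move=> UU sU.
have : (fun k => xi + ((k + 2).+1%:R)^-1 *: (eta - xi)) @ U --> xi + (0 : R) *: (eta - xi).
  apply: cvg_ray; try exact: cvg_cst.
  have := @cvg_harmonic R; rewrite -(cvg_shiftn 2).
  by apply: cvg_trans; exact: cvg_app.
rewrite scale0r addr0; suff -> : (fun k => xi + ((k + 2).+1%:R)^-1 *: (eta - xi)) =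
    (fun k => chord xi eta (ln k.+2%:R)) by [].
apply/funext => k; rewrite /chord lnK ?posrE ?ltr0n // addn2.
have -> : (1 + k.+2%:R : R) = k.+3%:R by rewrite nat1r.
have k0 : (k.+3%:R : R) != 0 by rewrite pnatr_eq0.
have -> : (k.+2%:R : R) = k.+3%:R - 1 by rewrite -(natr1 k.+2) addrK.
by apply/rowP => i; rewrite !mxE; field.
Qed.

(** ** Geodesics ending at an extreme point *)

(** Eliminating [z] from [x = s z - (s - 1) p] and [z = t y - (t - 1) q] gives
    [x = s t y - (s t - 1) e'] with [e'] between [p] and [q]. This is the triangle
    inequality for [ln M], with its equality case. *)
Lemma exits_comp x y z s p t q K e :
  D y -> exits x z s p -> exits z y t q -> exits x y K e ->
  K <= s * t /\ (K = s * t -> exists c d,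
    [/\ 0 < c, 0 < d, c + d = 1 & e = c *: p + d *: q]).
Proof.
move=> Dy [s1 [cp _] xE] [t1 [cq _] zE] xyK.
have st1 : 1 < s * t by rewrite mulr_egt1.
pose c := (s - 1) / (s * t - 1); pose d := s * (t - 1) / (s * t - 1).
have c0 : 0 < c by rewrite divr_gt0 //; lra.
have d0 : 0 < d by rewrite divr_gt0 ?mulr_gt0 //; lra.
have cd : c + d = 1 by rewrite /c /d; field; lra.
have xE' : x = (s * t) *: y - (s * t - 1) *: (c *: p + d *: q).
  by rewrite xE zE; apply/rowP => i; rewrite !mxE /c /d; field; lra.
split; first apply: (exits_le Dy xyK st1 _ xE').
  by apply: (iffLR (convex_setP _) (convex_closure D_convex)) => //; exact: ltW.
move=> KE; exists c, d; split=> //; have [_ _ xKE] := xyK.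
move: xE'; rewrite {1}xKE KE => /addrI/oppr_inj.
by apply: scalerI; lra.
Qed.

(** Equality in the triangle inequality for [h] forces equality in
    [exits_comp], so [xi] is a convex combination, with positive weights, of the
    exit points of the rays from [x] through [z] and from [z] through [y]. As [xi] is
    extreme, both are [xi], and [z] lies on the segment from [x] to [xi]. *)
Lemma hilbert_between_extreme x y z M xi :
  D x -> D y -> D z -> exits x y M xi -> extreme (closure D) xi ->
  hilbert_dist D x z + hilbert_dist D z y = hilbert_dist D x y ->
  exists2 a, 0 < a <= 1 & z = a *: x + (1 - a) *: xi.
Proof.
move=> Dx Dy Dz xyM [_ ext]; have [M1 [cxi _] xE] := xyM.
have [<- _|xz] := eqVneq x z.
  by exists 1; rewrite ?ltr01 ?lexx // scale1r subrr scale0r addr0.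
have [->|zy] := eqVneq z y.
  move=> _; exists M^-1.
    by rewrite invr_gt0 invf_le1; lra.
  by rewrite xE; apply/rowP => i; rewrite !mxE; field; lra.
have yx : y != x by rewrite eq_sym; exact: exits_neq xyM.
have [N [eta yxN]] := exits_exists Dy Dx yx.
have [al [a xza]] := exits_exists Dx Dz xz.
have [be [b zyb]] := exits_exists Dz Dy zy.
have [|al' [a' zxa]] := exits_exists Dz Dx; first by rewrite eq_sym.
have [|be' [b' yzb]] := exits_exists Dy Dz; first by rewrite eq_sym.
rewrite (hilbertE Dx Dz xza zxa) (hilbertE Dz Dy zyb yzb) (hilbertE Dx Dy xyM yxN).
have [Mle Meq] := exits_comp Dy xza zyb xyM.
have [Nle _] := exits_comp Dx yzb zxa yxN.
have [al1 [ca _] xaE] := xza; have [be1 [cb _] _] := zyb.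
have [al'1 _ _] := zxa; have [be'1 _ _] := yzb; have [N1 _ _] := yxN.
have p1 : 0 < al * al' by rewrite mulr_gt0 //; lra.
have p2 : 0 < be * be' by rewrite mulr_gt0 //; lra.
have p3 : 0 < M * N by rewrite mulr_gt0 //; lra.
rewrite -lnM ?posrE // => /ln_inj; rewrite !posrE mulr_gt0 // => /(_ isT p3) E.
have ME : M = al * be.
  apply/eqP; rewrite eq_le Mle /= leNgt; apply/negP => Mlt.
  have : M * N < al * be * (be' * al').
    apply: (@le_lt_trans _ _ (M * (be' * al'))); first by rewrite ler_pM2l //; lra.
    by rewrite ltr_pM2r // mulr_gt0 //; lra.
  by rewrite -E => /lt_eqF/eqP; apply; ring.
have [c [d [c0 d0 cd xiE]]] := Meq ME.
have aE : a = xi by apply: (ext a b c d).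
exists al^-1; first by rewrite invr_gt0 invf_le1; lra.
by rewrite xaE aE; apply/rowP => i; rewrite !mxE; field; lra.
Qed.

Lemma chord_between_extreme xi eta t r z :
  frontier xi -> frontier eta -> extreme (closure D) xi ->
  D (chord xi eta t) -> D z -> t < r ->
  hilbert_dist D (chord xi eta t) z + hilbert_dist D z (chord xi eta r)
    = hilbert_dist D (chord xi eta t) (chord xi eta r) ->
  exists s, z = chord xi eta s.
Proof.
move=> fxi feta ext Dt Dz tr.
have Dr : D (chord xi eta r) by apply: chord_in Dt; [case: fxi|case: feta].
move=> /(hilbert_between_extreme Dt Dr Dz (chord_exits eta fxi tr) ext)[a /andP[a0 a1] ->].
have t0 := expR_gt0 t.
have u0 : 0 < (1 + expR t) / a - 1 by rewrite subr_gt0 ltr_pdivlMr; lra.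
exists (ln ((1 + expR t) / a - 1)); rewrite /chord lnK ?posrE //.
by apply/rowP => i; rewrite !mxE; field; rewrite !gt_eqF //=; lra.
Qed.

End Hilbert.

(** * Uniquely geodesic lines in a normed space *)

Section NormedLines.
Context {R : realType} {V : normedModType R}.
Implicit Types (u w : V) (s t r : R).

(** For a unit vector [u]: every point metrically between [0] and [t u] lies on
    the segment joining them. By translation, the segments parallel to [u] are the
    only geodesics between their endpoints. *)
Definition uniquely_geodesic u :=
  forall t w, 0 < t -> `|w| + `|t *: u - w| = t -> w = `|w| *: u.

(** The point dividing [g s], [g t] in a given ratio in the normed space is in the
    range of [g], and its distances to [g s] and [g t] determine its parameter; so
    [g] is affine. *)
Lemma geodesic_line (g : R -> V) :
  (forall s t, `|g t - g s| = `|t - s|) ->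
  (forall s t w, s < t -> `|w - g s| + `|g t - w| = t - s -> exists r, w = g r) ->
  exists u, [/\ `|u| = 1, forall t, g t = g 0 + t *: u & uniquely_geodesic u].
Proof.
move=> giso gbtw.
have E s t l : s < t -> 0 <= l -> l <= 1 ->
    g (s + l * (t - s)) = g s + l *: (g t - g s).
  move=> st l0 l1; pose w := g s + l *: (g t - g s).
  have ws : `|w - g s| = l * (t - s).
    by rewrite /w addrAC subrr add0r normrZ giso !ger0_norm // subr_ge0 ltW.
  have wt : `|g t - w| = (1 - l) * (t - s).
    have -> : g t - w = (1 - l) *: (g t - g s).
      by rewrite /w opprD addrA scalerBl scale1r.
    by rewrite normrZ giso !ger0_norm // subr_ge0 // ltW.
  have [|r wr] := gbtw s t w st; first by rewrite ws wt; ring.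
  move: ws wt; rewrite -/w wr !giso => rs rt.
  congr g; move: rs rt.
  have : 0 <= l * (t - s) by rewrite mulr_ge0 // subr_ge0 ltW.
  by case: (ger0P (r - s)) => ?; case: (ger0P (t - r)) => ?; lra.
pose u := g 1 - g 0.
have gE t : g t = g 0 + t *: u.
  have [t0|t0] := lerP 0 t; last first.
    have := @E t 1 (- t / (1 - t)); rewrite /u => /(_ _ _ _)/wrap[].
    - lra.
    - by rewrite divr_ge0 //; lra.
    - by rewrite ler_pdivrMr; lra.
    have -> : t + - t / (1 - t) * (1 - t) = 0 by field; lra.
    set l := - t / (1 - t) => g0E.
    have tE : t *: (g 1 - g 0) = - (l *: (g 1 - g t)).
      have -> : g 1 - g 0 = (1 - l) *: (g 1 - g t).
        by rewrite g0E opprD addrA scalerBl scale1r.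
      have tl : t * (1 - l) = - l by rewrite /l; field; lra.
      by rewrite scalerA tl scaleNr.
    by rewrite tE g0E addrK.
  have [t1|t1] := lerP t 1.
    by have := @E 0 1 t ltr01 t0 t1; rewrite !subr0 mulr1 add0r.
  have := @E 0 t t^-1; rewrite subr0 add0r mulVf ?gt_eqF //; last lra.
  move=> /(_ _ _ _)/wrap[].
  - lra.
  - by rewrite invr_ge0; lra.
  - by rewrite invf_le1; lra.
  move=> g1E; have -> : u = t^-1 *: (g t - g 0) by rewrite /u g1E addrAC subrr add0r.
  by rewrite scalerA divff ?scale1r ?gt_eqF //; [rewrite addrC subrK|lra].
exists u; split=> //; first by rewrite /u giso subr0 normr1.
move=> t w t0 wt.
have [|r wr] := gbtw 0 t (g 0 + w) t0.
  by rewrite [g 0 + w - _]addrAC subrr add0r subr0 (gE t) opprD addrACA subrr add0r.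
have wE : w = r *: u by apply: (addrI (g 0)); rewrite wr -gE.
have nu : `|u| = 1 by rewrite /u giso subr0 normr1.
move: wt; rewrite wE -scalerBl !normrZ nu !mulr1.
move=> wt; rewrite ger0_norm //; move: wt t0; clear.
by case: (ger0P r) => //; case: (ger0P (t - r)); lra.
Qed.

End NormedLines.


(** * The cone property at an extreme point *)

(** The functional is kept explicit because it becomes the barycentric coordinate
    of the vertex [xi]. *)
Definition cone_at (R : realType) n (D : set 'rV[R]_n) xi w c :=
  [/\ forall z, closure D z -> 0 <= aff w c z, aff w c xi = 1 &
    forall q, closure D q ->
      exists z, [/\ closure D z, aff w c z = 0 & in_segment q z xi]].

Section Cone.
Context {R : realType} {n : nat} {D : set 'rV[R]_n}.
Hypothesis hn : (0 < n)%N.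
Hypothesis hD : bounded_convex_domain D.
Context {V : normedModType R} {f : 'rV[R]_n -> V}.
Hypothesis fsurj : f @` D = [set: V].
Hypothesis fiso : forall x y, D x -> D y -> `|f x - f y| = hilbert_dist D x y.
Implicit Types (x y z p q xi eta : 'rV[R]_n) (t r : R) (u v : V).

Lemma extreme_notin xi : extreme (closure D) xi -> ~ D xi.
Proof.
move=> [_ ext] Dxi.
pose v : 'rV[R]_n := const_mx 1.
have [_ oD _ _] := hD; have [e e0 [Dp Dm]] := open_line v oD Dxi.
have /(congr1 (fun w : 'rV_n => w 0 (Ordinal hn))) : xi + e *: v = xi.
  apply: (ext _ (xi - e *: v) (1/2) (1/2));
    [exact: subset_closure|exact: subset_closure|lra|lra|lra|].
  by apply/rowP => i; rewrite !mxE; lra.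
by rewrite !mxE; lra.
Qed.

Lemma isometry_preimage v : exists2 x, D x & f x = v.
Proof. by have : [set: V] v by []; rewrite -fsurj => -[x Dx <-]; exists x. Qed.

Lemma isometry_inj x y : D x -> D y -> f x = f y -> x = y.
Proof.
move=> Dx Dy fxy; apply: (hilbert_eq0 hD Dx Dy).
by rewrite -fiso // fxy subrr normr0.
Qed.

(** Straight segments of [D] are geodesics, so the preimage of a uniquely
    geodesic segment of [V] is straight. *)
Lemma preimage_segment x y z u t r :
  uniquely_geodesic u -> `|u| = 1 -> D x -> D y -> D z ->
  0 < t -> 0 <= r -> r <= t -> f y = f x + t *: u -> f z = f x + r *: u ->
  in_segment z x y.
Proof.
move=> uu u1 Dx Dy Dz t0 r0 rt fy fz.
have xy : x != y.
  apply/eqP => xy; move: fy; rewrite xy -{1}(addr0 (f y)) => /addrI/esym/eqP.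
  by rewrite scaler_eq0 (gt_eqF t0) -normr_eq0 u1 oner_eq0.
have [xi [eta [s [s' [fxi feta ss xE yE]]]]] := chord_through hD Dx Dy xy.
have Dxi : D (chord xi eta s) by rewrite -xE.
have Dc s1 : D (chord xi eta s1) by apply: (chord_in hD _ _ _ Dxi); [case: fxi|case: feta].
have dist s1 s2 : `|f (chord xi eta s1) - f (chord xi eta s2)| = `|s2 - s1|.
  by rewrite fiso // hilbert_chord.
have ts : t = s' - s.
  have := dist s' s; rewrite -xE -yE fy addrAC subrr add0r normrZ u1 mulr1.
  by rewrite gtr0_norm // ltr0_norm ?opprB // subr_lt0.
have fq : f (chord xi eta (s + r)) = f z.
  pose w := f (chord xi eta (s + r)) - f x.
  suff wu : w = r *: u by rewrite fz -wu [RHS]addrC subrK.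
  have wr : `|w| = r.
    by rewrite /w xE dist opprD addrA subrr sub0r normrN ger0_norm.
  rewrite -wr; apply: (uu t) => //; rewrite wr.
  have -> : t *: u - w = f y - f (chord xi eta (s + r)).
    by rewrite /w fy opprB addrCA addrA.
  rewrite yE dist ler0_norm; first by rewrite ts; ring.
  by rewrite subr_le0 -lerBrDl -ts.
have <- : chord xi eta (s + r) = z by apply: isometry_inj.
rewrite xE yE; apply: chord_segment => //; first by rewrite lerDl.
by rewrite -lerBrDl -ts.
Qed.

(** The other end [eta] is where the ray from a point [q] of [D] between [xi] and
    [p] leaves [D] after passing through [p]. *)
Lemma chord_from_extreme xi p : extreme (closure D) xi -> D p ->
  exists eta t, frontier (D := D) eta /\ p = chord xi eta t.
Proof.
move=> ext Dp; have [cxi _] := ext.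
have nDxi := extreme_notin ext.
have xip : xi != p by apply/eqP => xip; rewrite xip in nDxi.
pose q := (1/2 : R) *: p + (1/2 : R) *: xi.
have [_ oD cD _] := hD.
have Dq : D q by apply: open_segment => //; lra.
have qp : q != p.
  apply: contra xip => /eqP qp; apply/eqP/rowP => i.
  by have := congr1 (fun w : 'rV_n => w 0 i) qp; rewrite !mxE; lra.
have [M [eta [M1 feta qE]]] := exits_exists hD Dq Dp qp.
exists eta, (ln (1 / (2 * (M - 1)))); split=> //.
have m0 : 0 < 1 / (2 * (M - 1)) by rewrite divr_gt0 //; lra.
rewrite /chord lnK ?posrE //; apply/rowP => i.
have := congr1 (fun w : 'rV_n => w 0 i) qE; rewrite !mxE => E.
have n0 : M - 1 / 2 != 0 by lra.
apply: (mulfI n0).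
have -> : (M - 1/2) * p 0 i = 1/2 * xi 0 i + (M - 1) * eta 0 i by lra.
by field; lra.
Qed.

(** The chord from [eta] to the extreme point [xi] is uniquely geodesic, so its
    image in [V] is a line [v0 + R u]; the preimage of each parallel line
    [f p + R u] is a chord through [p], at bounded distance from the first one.
    Forward, this chord can only end at [xi]; backward, it ends at a point [z]
    such that [eta] is interior to a segment of [closure D] starting at [z]. *)
Lemma parallel_chord xi p0 : extreme (closure D) xi -> D p0 ->
  exists2 eta, frontier (D := D) eta & forall p, D p ->
    exists z e, [/\ closure D z, 0 < e, closure D (eta + e *: (eta - z)) &
      in_segment p z xi].
Proof.
move=> ext Dp0; have nDxi := extreme_notin ext; have [cxi extxi] := ext.
have fxi : frontier (D := D) xi by [].
have cptD := compact_closure_domain hD.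
have [eta [s0 [feta p0E]]] := chord_from_extreme ext Dp0.
exists eta => // p Dp.
pose c t := chord xi eta t.
have Dc t : D (c t) by apply: (chord_in (t := s0) hD _ cxi); [case: feta|rewrite -p0E].
have [u [u1 fc uu]] : exists u,
    [/\ `|u| = 1, forall t, f (c t) = f (c 0) + t *: u & uniquely_geodesic u].
  apply: (geodesic_line (g := fun t => f (c t))) => [s t|s t w st].
    by rewrite fiso // hilbert_chord // distrC.
  have [z Dz <-] := isometry_preimage w; rewrite distrC [`|f (c t) - _|]distrC !fiso // => E.
  have [|r ->] := chord_between_extreme hD fxi feta ext (Dc s) Dz st; last by exists r.
  by rewrite E hilbert_chord // gtr0_norm ?subr_gt0.
have ex_c' t : exists x, D x /\ f x = f p + t *: u.
  by have [x Dx fx] := isometry_preimage (f p + t *: u); exists x.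
have [c' c'P] := choice ex_c'.
pose K := expR `|f p - f (c 0)| + 1; pose e := (K - 1)^-1.
have K1 : 1 < K by rewrite ltrDr expR_gt0.
have e0 : 0 < e by rewrite invr_gt0 subr_gt0.
have close t : closure D (c t + e *: (c t - c' t)).
  have [Dt ft] := c'P t.
  apply: (hilbert_le hD) => //; rewrite -fiso // ft fc opprD addrACA subrr addr0.
  rewrite -[leLHS]expRK ler_ln ?posrE ?expR_gt0 //; first by rewrite lerDl.
  exact: lt_trans K1.
have [U [UU sU]] := @ultraFilterLemma nat \oo _.
pose T (k : nat) : R := ln k.+2%:R.
have T2 k : T 0%N <= T k by rewrite ler_ln ?posrE ?ltr0n // ler_nat.
have T0 : 0 < T 0%N by rewrite ln_gt0 // ltr1n.
have ccv (zeta zeta' : 'rV[R]_n) : (fun k => chord zeta zeta' (T k)) @ U --> zeta.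
  exact: chord_cvg.
have cD' t : closure D (c' t) by apply: subset_closure; have [] := c'P t.
have lim_close x z (w w' : nat -> 'rV[R]_n) : w @ U --> x -> w' @ U --> z ->
    (forall k, closure D (w k + e *: (w k - w' k))) -> closure D (x + e *: (x - z)).
  move=> wx wz h; apply: (@closed_cvg _ _ U _ _ (closure D) (@closed_closure _ D) _ _ _ ).
    exact: (filterE _ h).
  by apply: cvg_ray => //; exact: cvg_cst.
pose q := c' (T 0%N).
have [Dq fq] := c'P (T 0%N).
have pq : p <> q.
  move=> pq; move: fq; rewrite -/q -pq -{1}(addr0 (f p)) => /addrI/esym/eqP.
  by rewrite scaler_eq0 (gt_eqF T0) -normr_eq0 u1 oner_eq0.
(* Forward, the limit [y] of the translated chord satisfies
   [xi + e (xi - y) \in closure D], and extremality of [xi] gives [y = xi]. *)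
have qseg : in_segment q p xi.
  have [y cy yl] := compact_ultra_cvg UU cptD (fun k => cD' (T k)).
  have cl := lim_close _ _ _ _ (ccv xi eta) yl (fun k => close (T k)).
  have yxi : y = xi.
    apply: (extxi y (xi + e *: (xi - y)) (e / (1 + e)) (1 / (1 + e))) => //.
    - by rewrite divr_gt0 // addr_gt0.
    - by rewrite divr_gt0 // addr_gt0.
    - by field; rewrite gt_eqF // addr_gt0.
    - by apply/rowP => i; rewrite !mxE; field; rewrite gt_eqF // addr_gt0.
  rewrite yxi in yl.
  apply: (segment_limit UU (cvg_cst q) (cvg_cst p) yl) => k.
  have [Dk fk] := c'P (T k).
  exact: (preimage_segment uu u1 Dp Dk Dq (lt_le_trans T0 (T2 k)) (ltW T0) (T2 k)).
(* Backward, the first chord tends to [eta], which need not be extreme: only the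
   face of the limit [z] is determined. *)
have [z cz zl] := compact_ultra_cvg UU cptD (fun k => cD' (- T k)).
exists z, e; split=> //.
  have := lim_close _ _ _ _ (ccv eta xi) zl; apply => k.
  by rewrite -(chord_sym eta xi); exact: close.
have pseg : in_segment p z q.
  apply: (segment_limit UU (cvg_cst p) zl (cvg_cst q)) => k.
  have [Dk fk] := c'P (- T k); have Tk := T2 k.
  have Tk0 := le_trans (ltW T0) Tk.
  apply: (preimage_segment uu u1 Dk Dq Dp (ltr_wpDl Tk0 T0) Tk0).
  - by rewrite lerDl ltW.
  - by rewrite fk fq -addrA -scalerDl addrA addNr add0r.
  - by rewrite fk -addrA -scalerDl addNr scale0r addr0.
exact: segment_trans pseg qseg pq.
Qed.

(** The base lies in a hyperplane supporting [D] at the point [eta] of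
    [parallel_chord]: each backward end [z] is on this hyperplane because [eta] is
    interior to a segment of [closure D] starting at [z]. *)
Lemma extreme_cone xi : extreme (closure D) xi ->
  exists w c, cone_at D xi w c.
Proof.
move=> ext; have [[p0 Dp0] oD cD _] := hD; have [cxi _] := ext.
have [eta [ceta nDeta] par] := parallel_chord ext Dp0.
have [v v0 vsup] := supporting_normal hD Dp0 ceta nDeta.
have cone p : D p -> exists z, [/\ closure D z, dot (z - eta) v = 0 & in_segment p z xi].
  move=> /par[z [e [cz e0 ce seg]]]; exists z; split=> //.
  apply/eqP; rewrite eq_le vsup //=.
  have := vsup _ ce; rewrite addrAC subrr add0r dotZl -(opprB z eta) -scaleN1r dotZl.
  by rewrite mulN1r mulrN oppr_le0 pmulr_rge0.
have xi0 : dot (xi - eta) v < 0.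
  rewrite lt_neqAle vsup // andbT; apply/eqP => xi0.
  have D0 p : D p -> dot (p - eta) v = 0.
    move=> /cone[z [_ z0 [a [b [_ _ ab ->]]]]].
    have -> : a *: z + b *: xi - eta = a *: (z - eta) + b *: (xi - eta).
      by rewrite -[in LHS](scale1r eta) -ab; apply/rowP => i; rewrite !mxE; ring.
    by rewrite dot_comb z0 xi0 !mulr0 addr0.
  have [e e0 [Dpe _]] := open_line v oD Dp0.
  have := D0 _ Dpe; rewrite addrAC -[p0 - eta]scale1r dot_comb (D0 _ Dp0) mulr0 add0r.
  by move=> /eqP; rewrite mulf_eq0 (gt_eqF e0) => /eqP/dot_eq0.
set d := dot (xi - eta) v in xi0.
exists (d^-1 *: v), (- dot eta (d^-1 *: v)).
have affE x : aff (d^-1 *: v) (- dot eta (d^-1 *: v)) x = dot (x - eta) v / d.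
  by rewrite /aff -dotBl dotZr mulrC.
split=> [z cz||q cq].
- by rewrite affE ler_ndivlMr // mul0r; exact: vsup.
- by rewrite affE divff // lt_eqF.
pose qk (k : nat) := (k.+1%:R^-1 : R) *: p0 + (1 - k.+1%:R^-1) *: q.
have Dqk k : D (qk k).
  apply: open_segment => //; first by rewrite subr_ge0 invf_le1 // ler1n.
  by rewrite addrC subrK.
have [zk zkP] := choice (fun k => cone _ (Dqk k)).
have [U [UU sU]] := @ultraFilterLemma nat \oo _.
have [|z cz zl] := compact_ultra_cvg (z := zk) UU (compact_closure_domain hD).
  by move=> k; have [] := zkP k.
exists z; split=> //.
  rewrite affE.
  have : (fun k => dot (zk k - eta) v) @ U --> dot (z - eta) v.
    by apply: cvg_dot; [apply: cvgB => //; exact: cvg_cst|exact: cvg_cst].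
  have -> : (fun k => dot (zk k - eta) v) = cst 0.
    by apply/funext => k; have [] := zkP k.
  move=> /(cvg_unique (@norm_hausdorff R R^o))/(_ (cvg_cst _)) z0.
  by rewrite z0 mul0r.
apply: (segment_limit (p := qk) UU _ zl (cvg_cst xi)); last by move=> k; have [] := zkP k.
have : (fun k => (k.+1%:R^-1 : R) *: p0 + (1 - k.+1%:R^-1) *: q) @ U -->
    (0 : R) *: p0 + (1 - 0 : R) *: q.
  have h0 : (fun k => k.+1%:R^-1 : R) @ U --> (0 : R).
    by apply: cvg_trans (@cvg_harmonic R); exact: cvg_app.
  apply: cvg_comb; rewrite ?subr0; [exact: h0| |exact: cvg_cst|exact: cvg_cst].
  by rewrite -[X in _ --> X]subr0; apply: cvgB => //; exact: cvg_cst.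
by rewrite scale0r add0r subr0 scale1r.
Qed.

End Cone.

(** * Convex hulls and homogeneous coordinates *)

Section Simplex.
Context {R : realType} {n : nat}.
Implicit Types (x y z q xi zeta w : 'rV[R]_n) (A D : set 'rV[R]_n) (c : R).

Lemma convex_hull_convex A : @convex_set R 'rV[R]_n (convex_hull A).
Proof.
apply/convex_setP => x y a b Ax Ay a0 b0 ab B [cB AB].
apply: (iffLR (convex_setP B) cB) => //; [exact: Ax|exact: Ay].
Qed.

Lemma sub_convex_hull A : A `<=` convex_hull A.
Proof. exact: sub_smallest. Qed.

Lemma convex_hull_min A B : @convex_set R 'rV[R]_n B -> A `<=` B -> convex_hull A `<=` B.
Proof. exact: smallest_sub. Qed.

(** Homogeneous coordinates, which turn affine combinations and affine functions
    into matrix products. *)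
Definition homog m (p : 'I_m -> 'rV[R]_n) : 'M[R]_(m, 1 + n) :=
  \matrix_i row_mx 1%:M (p i).

Lemma mul_homog m (p : 'I_m -> 'rV[R]_n) (v : 'rV[R]_m) :
  v *m homog p = row_mx (\sum_i v 0 i)%:M (\sum_i v 0 i *: p i).
Proof.
rewrite mulmx_sum_row -[LHS]hsubmxK; congr row_mx; apply/rowP => k; rewrite !mxE summxE.
  rewrite (ord1 k) mulr1n; apply: eq_bigr => i _.
  by rewrite mxE rowK row_mxEl mxE mulr1.
by rewrite summxE; apply: eq_bigr => i _; rewrite mxE rowK row_mxEr mxE.
Qed.

Lemma homog_free m (p : 'I_m -> 'rV[R]_n) :
  affinely_independent p -> row_free (homog p).
Proof.
move=> ap; apply: inj_row_free => v; rewrite mul_homog -[RHS]row_mx0 => /eq_row_mx[s0 v0].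
apply/rowP => i; rewrite mxE; apply: (ap (fun i => v 0 i)) => //.
by move/(congr1 (fun M : 'M[R]_1 => M 0 0)): s0; rewrite !mxE eqxx mulr1n.
Qed.

Lemma affinely_independent_card m (p : 'I_m -> 'rV[R]_n) :
  affinely_independent p -> (m <= n.+1)%N.
Proof. by move=> /homog_free/eqP <-; exact: rank_leq_col. Qed.

Lemma homog_aff m (p : 'I_m -> 'rV[R]_n) (u : 'cV[R]_(1 + n)) i :
  (homog p *m u) i 0 = aff (dsubmx u)^T (u 0 0) (p i).
Proof.
rewrite mxE big_split_ord big_ord1 /= /aff /dot addrC; congr (_ + _).
  by apply: eq_bigr => k _; rewrite [homog _ _ _]mxE row_mxEr !mxE.
rewrite [homog _ _ _]mxE row_mxEl mxE mulr1n mul1r.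
by congr (u _ _); exact/val_inj.
Qed.

(** A nonzero column of the cokernel of [homog p] is such an affine function. *)
Lemma common_hyperplane m (p : 'I_m -> 'rV[R]_n) : (m < n.+1)%N ->
  exists w c, (w, c) <> (0, 0) /\ forall i, aff w c (p i) = 0.
Proof.
move=> mn; have : cokermx (homog p) != 0.
  rewrite -mxrank_eq0 mxrank_coker subn_eq0 -ltnNge.
  exact: leq_ltn_trans (rank_leq_row _) mn.
move=> /matrix0Pn[i [j uij]]; pose u := col j (cokermx (homog p)).
exists (dsubmx u)^T, (u 0 0); split=> [[w0 c0]|k].
  move: uij; have : u = 0.
    rewrite -[u]vsubmxK -[dsubmx u]trmxK w0 trmx0.
    have -> : usubmx u = 0.
      apply/colP => k; rewrite [LHS]mxE [RHS]mxE -[RHS]c0 (ord1 k).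
      by congr (u _ _); exact/val_inj.
    exact: col_mx0.
  by move=> /colP/(_ i); rewrite !mxE => ->; rewrite eqxx.
by rewrite -homog_aff /u colE mulmxA mulmx_coker mul0mx mxE.
Qed.

Lemma aff_eq0 D w c : bounded_convex_domain D ->
  (forall x, D x -> aff w c x = 0) -> (w, c) = (0, 0).
Proof.
move=> hD D0; have [[p Dp] oD _ _] := hD.
have [e e0 [De _]] := open_line w oD Dp.
have Hp := D0 _ Dp; have := D0 _ De.
have -> : p + e *: w = 1 *: p + e *: w by rewrite scale1r.
rewrite /aff dot_comb mul1r => H.
have w0 : w = 0.
  apply/dot_eq0/(mulfI (lt0r_neq0 e0)); rewrite mulr0.
  by move: Hp H; rewrite /aff; lra.
move: Hp; rewrite w0 /aff /dot big1 ?add0r => [->//|i _].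
by rewrite mxE mulr0.
Qed.

(** * A domain that is a cone at each of its extreme points is a simplex *)

(** An extreme point is not inside a segment from the base to the apex. *)
Lemma cone_at_other_extreme D xi w c zeta :
  extreme (closure D) xi -> cone_at D xi w c -> extreme (closure D) zeta ->
  zeta != xi -> aff w c zeta = 0.
Proof.
move=> [cxi _] [_ _ cone] [czeta ext] zx.
have [z [cz z0 [a [b [a0 b0 ab zE]]]]] := cone zeta czeta.
have [b_eq0|b_neq0] := eqVneq b 0.
  have a1 : a = 1 by rewrite b_eq0 addr0 in ab.
  by rewrite zE b_eq0 a1 scale0r scale1r addr0.
have [a_eq0|a_neq0] := eqVneq a 0.
  have b1 : b = 1 by rewrite a_eq0 add0r in ab.
  by move: zx; rewrite zE a_eq0 b1 scale0r scale1r add0r eqxx.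
move: zx; rewrite (ext xi z b a) ?eqxx //.
- by rewrite lt_neqAle eq_sym b_neq0.
- by rewrite lt_neqAle eq_sym a_neq0.
- by rewrite addrC.
- by rewrite addrC.
Qed.

(** The functionals of the cones are dual to the extreme points. A largest family
    of extreme points spans: the common zeros of its functionals in [closure D]
    form a face, and a nonempty face would provide another extreme point. *)
Lemma cones_simplex D : bounded_convex_domain D ->
  (forall xi, extreme (closure D) xi -> exists w c, cone_at D xi w c) ->
  exists S : set 'rV[R]_n, is_simplex S /\ D = S°.
Proof.
move=> hD cones; have [[p0 Dp0] oD cD _] := hD.
have cptD := compact_closure_domain hD.
pose family m (xi : 'I_m -> 'rV[R]_n) := injective xi /\ forall i, extreme (closure D) (xi i).
have duals m (xi : 'I_m -> 'rV[R]_n) : family m xi ->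
    exists (w : 'I_m -> 'rV[R]_n) (c : 'I_m -> R), (forall i, cone_at D (xi i) (w i) (c i)) /\
      forall i j, aff (w i) (c i) (xi j) = (i == j)%:R.
  move=> [inj ext].
  have [w wP] := choice (fun i => cones _ (ext i)).
  have [c cP] := choice wP.
  exists w, c; split=> // i j; have [<-|ij] := eqVneq i j.
    by have [_ -> _] := cP i.
  apply: (cone_at_other_extreme (ext i) (cP i) (ext j)).
  by rewrite (inj_eq inj) eq_sym.
have indep m (xi : 'I_m -> 'rV[R]_n) : family m xi -> affinely_independent xi.
  move=> /duals[w [c [_ dual]]] a a0 axi i.
  have : \sum_j a j * aff (w i) (c i) (xi j) = 0.
    rewrite /aff; under eq_bigr do rewrite mulrDr.
    rewrite big_split /= -mulr_suml a0 mul0r addr0.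
    transitivity (dot (\sum_j a j *: xi j) (w i)); last first.
      by rewrite axi /dot big1 // => k _; rewrite mxE mul0r.
    rewrite /dot; under [RHS]eq_bigr do rewrite summxE mulr_suml.
    rewrite exchange_big /=; apply: eq_bigr => j _; rewrite mulr_sumr.
    by apply: eq_bigr => k _; rewrite mxE mulrA.
  rewrite (bigD1 i) //= dual eqxx mulr1 big1 ?addr0 // => j ji.
  by rewrite dual eq_sym (negbTE ji) mulr0.
(* a largest family exists, as affinely independent families have at most [n + 1]
   members *)
have [m [[xi fam] max]] : exists m, (exists xi : 'I_m -> 'rV[R]_n, family m xi) /\
    forall m', (exists xi : 'I_(m') -> 'rV[R]_n, family m' xi) -> (m' <= m)%N.
  pose P m := `[< exists xi : 'I_m -> 'rV[R]_n, family m xi >].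
  have P0 : exists m, P m.
    by exists 0%N; apply/asboolP; exists (fun=> 0); split=> [[]|[]].
  have Pb m : P m -> (m <= n.+1)%N.
    by move=> /asboolP[xi /indep]; exact: affinely_independent_card.
  have [m /asboolP Pm max] := ex_maxnP P0 Pb.
  by exists m; split=> // m' Pm'; apply/max/asboolP.
have [w [c [cone dual]]] := duals _ _ fam; have [inj ext] := fam.
pose F := [set z | closure D z /\ forall i, aff (w i) (c i) z = 0].
have F0 z : ~ F z.
  move=> Fz.
  have cF : compact F.
    apply: (subclosed_compact _ cptD) => [|? []//].
    have -> : F = closure D `&` \bigcap_i [set z | aff (w i) (c i) z = 0].
      by apply/seteqP; split=> x [cx h]; split=> // i; [by move=> _; exact: h|exact: (h i I)].
    apply: closedI; first exact: closed_closure.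
    apply: closed_bigI => i _.
    apply: (iffLR (continuous_closedP (fun x => aff (w i) (c i) x)) _ _ (@closed_eq R 0)) => x.
    apply: (@cvgD _ _ _ (nbhs x)); last exact: cvg_cst.
    by apply: (@cvg_dot _ _ _ (nbhs x)); (exact: cvg_id || exact: cvg_cst).
  have [|zeta [[czeta zeta0] extz]] := extreme_exists cF; first by exists z.
  (* [F] is cut out of [closure D] by functionals that are nonnegative there, so it is
     a face, and its extreme points are extreme in [closure D] *)
  have ez : extreme (closure D) zeta.
    split=> // x y a b cx cy a0 b0 ab zE; apply: (extz x y a b) => //; split=> // i;
    have := zeta0 i; rewrite zE (aff_comb _ _ _ _ ab);
    have [ge0 _ _] := cone i; have := ge0 x cx; have := ge0 y cy => y0 x0 /eqP;
    by rewrite (paddr_eq0 (mulr_ge0 (ltW a0) x0) (mulr_ge0 (ltW b0) y0)) !mulf_eq0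
      (gt_eqF a0) (gt_eqF b0) /= => /andP[/eqP ? /eqP].
  pose xi' (i : 'I_m.+1) := if unlift ord0 i is Some j then xi j else zeta.
  suff : (m.+1 <= m)%N by rewrite ltnn.
  have zxi j : zeta <> xi j.
    by move=> zj; have := zeta0 j; rewrite zj dual eqxx; apply/eqP/oner_neq0.
  apply: max; exists xi'; split=> [i j|i]; rewrite /xi'; last by case: unliftP.
  case: unliftP => [i'|] ->; case: unliftP => [j'|] -> //.
  - by move=> /inj ->.
  - by move/esym/zxi.
  - by move/zxi.
have hullE : closure D = convex_hull (range xi).
  apply/seteqP; split; last first.
    apply: convex_hull_min; first exact: convex_closure.
    by move=> _ [i _ <-]; have [] := ext i.
  (* One step writes [q] as a combination of the vertex [xi i0] and a point of the
     opposite face, at which one more functional vanishes; when all of them vanish,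
     the point is in [F], which is empty. *)
  have peel k q : (k <= m)%N -> closure D q ->
      (forall i : 'I_m, (k <= i)%N -> aff (w i) (c i) q = 0) -> convex_hull (range xi) q.
    elim: k q => [|k IH] q km cq q0.
      by exfalso; apply: (@F0 q); split=> // i; exact: q0.
    pose i0 := Ordinal km.
    have [_ xi1 /(_ q cq)[z [cz z0 [a [b [a0 b0 ab qE]]]]]] := cone i0.
    have hxi : convex_hull (range xi) (xi i0) by apply: sub_convex_hull; exists i0.
    have [a_eq0|a_neq0] := eqVneq a 0.
      have b1 : b = 1 by rewrite a_eq0 add0r in ab.
      by rewrite qE a_eq0 b1 scale0r scale1r add0r.
    rewrite qE; apply: (iffLR (convex_setP _) (@convex_hull_convex _)) => //.
    apply: IH => // [|i]; first exact: ltnW.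
    rewrite leq_eqVlt => /orP[/eqP ki|ki].
      by have -> : i = i0 by exact/val_inj.
    have := q0 i ki; rewrite qE (aff_comb _ _ _ _ ab) dual.
    have -> : (i == i0) = false by apply/eqP => ii; move: ki; rewrite ii /= ltnn.
    by rewrite mulr0 addr0 => /eqP; rewrite mulf_eq0 (negbTE a_neq0) => /eqP.
  by move=> q cq; apply: (peel m q) => // i; rewrite leqNgt ltn_ord.
have mE : m = n.+1.
  apply/eqP; rewrite eqn_leq (affinely_independent_card (indep _ _ fam)) /= leqNgt.
  apply/negP => /(@common_hyperplane _ xi)[w' [c' [nz w0]]]; apply: nz.
  apply: (aff_eq0 hD) => x Dx.
  have : convex_hull (range xi) x by rewrite -hullE; exact: subset_closure.
  apply: (@convex_hull_min _ [set x | aff w' c' x = 0]); last by move=> _ [i _ <-]; exact: w0.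
  apply/convex_setP => y z a b /= y0 z0 _ _ ab.
  by rewrite (aff_comb _ _ _ _ ab) y0 z0 !mulr0 addr0.
exists (closure D); split; last by rewrite interior_closure.
move: xi fam {max w c cone dual inj ext F F0} hullE; rewrite mE => xi fam hullE.
by exists xi => //; exact: indep.
Qed.

End Simplex.

(** * A simplex is isometric to a normed space *)

Section OscNorm.
Context {R : realType} {n : nat}.
Implicit Types (u v : 'rV[R]_n) (l : R) (i j a b : 'I_(1 + n)).

Definition pad u i : R := row_mx (0 : 'rV[R]_1) u 0 i.

Lemma padD u v i : pad (u + v) i = pad u i + pad v i.
Proof.
rewrite /pad; have -> : row_mx (0 : 'rV[R]_1) (u + v) = row_mx 0 u + row_mx 0 v.
  by rewrite add_row_mx addr0.
by rewrite mxE.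
Qed.

Lemma padZ l u i : pad (l *: u) i = l * pad u i.
Proof.
rewrite /pad; have -> : row_mx (0 : 'rV[R]_1) (l *: u) = l *: row_mx 0 u.
  by rewrite scale_row_mx scaler0.
by rewrite mxE.
Qed.

(** The oscillation seminorm of [R^(n+1)], which vanishes on constants, read on the
    representatives modulo constants whose coordinate [0] is zero. *)
Definition osc u : R :=
  \big[Order.max/0]_(k : 'I_(1 + n) * 'I_(1 + n)) (pad u k.1 - pad u k.2).

Lemma osc_ge u i j : pad u i - pad u j <= osc u.
Proof. by rewrite /osc; exact: (le_bigmax 0 (fun k => pad u k.1 - pad u k.2) (i, j)). Qed.

Lemma osc_eq u a b : (forall i, pad u i <= pad u a) -> (forall i, pad u b <= pad u i) ->
  osc u = pad u a - pad u b.
Proof.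
move=> ha hb; apply/eqP; rewrite eq_le osc_ge andbT; apply/bigmax_leP; split.
  by rewrite subr_ge0.
by move=> k _; apply: lerB.
Qed.

Lemma osc_attained u : exists a b,
  [/\ forall i, pad u i <= pad u a, forall i, pad u b <= pad u i & osc u = pad u a - pad u b].
Proof.
pose a := [arg max_(i > ord0) pad u i]%O; pose b := [arg min_(i < ord0) pad u i]%O.
have ha i : pad u i <= pad u a by rewrite /a; case: arg_maxP => // k _; exact.
have hb i : pad u b <= pad u i by rewrite /b; case: arg_minP => // k _; exact.
by exists a, b; split=> //; exact: osc_eq.
Qed.

Lemma oscD u v : osc (u + v) <= osc u + osc v.
Proof.
have [a [b [_ _ ->]]] := osc_attained (u + v); rewrite !padD.
by have := osc_ge u a b; have := osc_ge v a b; lra.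
Qed.

Lemma oscZ l u : osc (l *: u) = `|l| * osc u.
Proof.
have [a [b [ha hb ->]]] := osc_attained u.
case: (ger0P l) => l0.
  rewrite (@osc_eq _ a b) ?padZ ?mulrBr // => i; rewrite !padZ; exact: ler_wpM2l.
rewrite (@osc_eq _ b a) ?padZ => [|i|i]; first by ring.
  by rewrite !padZ; apply: ler_wnM2l; rewrite ?hb // ltW.
by rewrite !padZ; apply: ler_wnM2l; rewrite ?ha // ltW.
Qed.

Lemma osc_eq0 u : osc u = 0 -> u = 0.
Proof.
move=> u0; apply/rowP => k; rewrite mxE.
have -> : u 0 k = pad u (rshift 1 k) by rewrite /pad row_mxEr.
have p0 : pad u (lshift n ord0) = 0 by rewrite /pad row_mxEl mxE.
have := osc_ge u (rshift 1 k) (lshift n ord0).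
have := osc_ge u (lshift n ord0) (rshift 1 k).
by rewrite u0 p0; lra.
Qed.

End OscNorm.

(** A copy of ['rV_n], which already carries the sup norm. *)
Definition osc_space (R : realType) (n : nat) : Type := 'rV[R]_n.

HB.instance Definition _ (R : realType) (n : nat) :=
  GRing.Lmodule.copy (osc_space R n) 'rV[R]_n.
HB.instance Definition _ (R : realType) (n : nat) :=
  Lmodule_isNormed.Build R (osc_space R n) (@oscD R n) (@oscZ R n) (@osc_eq0 R n).

Section Barycentric.
Context {R : realType} {n : nat} {p : 'I_n.+1 -> 'rV[R]_n}.
Hypothesis indep : affinely_independent p.
Implicit Types (x y : 'rV[R]_n) (i : 'I_(1 + n)).

Definition bary x : 'rV[R]_(1 + n) := row_mx 1%:M x *m invmx (homog p : 'M[R]_(1 + n)).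

Let homog_unit : (homog p : 'M[R]_(1 + n)) \in unitmx.
Proof. by rewrite -row_free_unit; exact: homog_free. Qed.

Lemma baryK x : \sum_i bary x 0 i = 1 /\ \sum_i bary x 0 i *: p i = x.
Proof.
have : bary x *m homog p = row_mx 1%:M x by rewrite /bary -mulmxA mulVmx // mulmx1.
rewrite mul_homog => /eq_row_mx[+ ->].
by move=> /(congr1 (fun M : 'M[R]_1 => M 0 0)); rewrite !mxE !eqxx !mulr1n.
Qed.

Lemma bary_unique (b : 'rV[R]_(1 + n)) : \sum_i b 0 i = 1 ->
  bary (\sum_i b 0 i *: p i) = b.
Proof. by move=> b1; rewrite /bary -b1 -mul_homog -mulmxA mulmxV // mulmx1. Qed.

Lemma bary_vertex i j : bary (p i) 0 j = (j == i)%:R.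
Proof.
pose d : 'rV[R]_(1 + n) := delta_mx 0 i.
have dE k : d 0 k = (k == i)%:R by rewrite mxE eqxx.
have <- : \sum_k d 0 k *: p k = p i.
  rewrite (bigD1 i) //= dE eqxx scale1r big1 ?addr0 // => k ki.
  by rewrite dE (negbTE ki) scale0r.
rewrite bary_unique ?dE //.
rewrite (bigD1 i) //= dE eqxx big1 ?addr0 // => k ki.
by rewrite dE (negbTE ki).
Qed.

Lemma bary_aff i : exists w c, forall x, bary x 0 i = aff w c x.
Proof.
pose u := col i (invmx (homog p : 'M[R]_(1 + n))).
exists (dsubmx u)^T, (u 0 0) => x.
rewrite -(homog_aff (fun _ : 'I_1 => x) u 0).
have -> : homog (fun _ : 'I_1 => x) = row_mx 1%:M x.
  by apply/matrixP => k l; rewrite mxE (ord1 k).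
by rewrite /u colE mulmxA -colE [RHS]mxE.
Qed.

Lemma bary_comb x y (a b : R) i : a + b = 1 ->
  bary (a *: x + b *: y) 0 i = a * bary x 0 i + b * bary y 0 i.
Proof. by have [w [c E]] := bary_aff i => ab; rewrite !E (aff_comb _ _ _ _ ab). Qed.

Lemma hull_bary : convex_hull (range p) = [set x | forall i, 0 <= bary x 0 i].
Proof.
apply/seteqP; split.
  apply: convex_hull_min.
    apply/convex_setP => x y a b /= x0 y0 a0 b0 ab i.
    by rewrite bary_comb // addr_ge0 // mulr_ge0.
  move=> _ [j _ <-] i.
  by rewrite bary_vertex ler0n.
move=> x /= x0; have [sum1 <-] := baryK x; set b := bary x in x0 sum1 *.
pose H := convex_hull (range p).
have [_ [q Hq ->]] : 0 <= \sum_i b 0 i /\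
    exists2 q, H q & \sum_i b 0 i *: p i = (\sum_i b 0 i) *: q.
  apply: (big_ind2 (fun (v : 'rV[R]_n) (s : R) => 0 <= s /\ exists2 q, H q & v = s *: q)).
  - split=> //; exists (p ord0); last by rewrite scale0r.
    by apply: sub_convex_hull; exists ord0.
  - move=> _ s _ t [s0 [x1 H1 ->]] [t0 [x2 H2 ->]]; split; first exact: addr_ge0.
    have [st|st] := eqVneq (s + t) 0.
      move: st => /eqP; rewrite paddr_eq0 // => /andP[/eqP -> /eqP ->].
      by exists x1; rewrite // !scale0r !addr0 scale0r.
    exists ((s / (s + t)) *: x1 + (t / (s + t)) *: x2).
      apply: (iffLR (convex_setP _) (@convex_hull_convex _ _ _)) => //.
      + by rewrite divr_ge0 // addr_ge0.
      + by rewrite divr_ge0 // addr_ge0.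
      + by rewrite -mulrDl divff.
    by rewrite scalerDr !scalerA ![(s + t) * _]mulrC !divfK.
  - by move=> i _; split=> //; exists (p i) => //; apply: sub_convex_hull; exists i.
by rewrite sum1 scale1r.
Qed.

Lemma interior_hull : (convex_hull (range p))° = [set x | forall i, 0 < bary x 0 i].
Proof.
rewrite hull_bary; apply/seteqP; split=> x.
  move=> hx i; have hx0 := interior_subset hx.
  rewrite lt_neqAle hx0 andbT; apply/eqP => xi0.
  (* moving away from the vertex [p i] makes the zero coordinate negative *)
  have : (fun e : R => x + e *: (x - p i)) @ (0 : R) --> x + (0 : R) *: (x - p i).
    by apply: (@cvg_ray _ _ _ (nbhs (0 : R))); (exact: cvg_id || exact: cvg_cst).
  rewrite scale0r addr0 => /(_ _ hx) /nbhs_ballP[e /= e0 he].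
  have e2 : 0 < e / 2 by rewrite divr_gt0.
  have := he (e / 2); rewrite /ball /= sub0r normrN gtr0_norm // => /(_ _ i)/wrap[].
    by lra.
  have -> : x + (e / 2) *: (x - p i) = (1 + e / 2) *: x + (- (e / 2)) *: p i.
    by apply/rowP => k; rewrite !mxE; ring.
  rewrite bary_comb; last by ring.
  by rewrite -xi0 mulr0 add0r bary_vertex eqxx mulr1 oppr_ge0 leNgt e2.
move=> x0; have : \forall y \near x, forall i, 0 < bary y 0 i.
  apply: (@filter_forall _ _ _ (nbhs x)) => i.
  have [w [c E]] := bary_aff i.
  have cb : (fun y => bary y 0 i) @ x --> bary x 0 i.
    under eq_fun do rewrite E; rewrite E.
    apply: (@cvgD _ _ _ (nbhs x)); last exact: cvg_cst.
    by apply: (@cvg_dot _ _ _ (nbhs x)); (exact: cvg_id || exact: cvg_cst).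
  exact: (cvgr_gt _ cb _ (x0 i)).
by apply: filterS => y y0 i; exact: ltW.
Qed.

Context {D : set 'rV[R]_n}.
Hypothesis hD : bounded_convex_domain D.
Hypothesis DE : D = (convex_hull (range p))°.

Let D_bary x : D x <-> forall i, 0 < bary x 0 i.
Proof. by rewrite DE interior_hull. Qed.

Lemma simplex_closure e : (forall i, 0 <= bary e 0 i) -> closure D e.
Proof.
move=> e0; have [[q Dq] _ _ _] := hD.
have q0 := iffLR (D_bary q) Dq.
pose ek (k : nat) := e + (k.+1%:R^-1 : R) *: (q - e).
have ekl : ek @ \oo --> e + (0 : R) *: (q - e).
  by apply: cvg_ray; (exact: cvg_harmonic || exact: cvg_cst).
rewrite scale0r addr0 in ekl.
apply: (@closed_cvg _ _ \oo _ ek (closure D) (@closed_closure _ D) _ _ ekl).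
apply: nearW => k; apply/subset_closure/D_bary => i; rewrite /ek.
set s : R := k.+1%:R^-1.
have s0 : 0 < s by rewrite invr_gt0 ltr0n.
have s1 : s <= 1 by rewrite invf_le1 ?ltr0n // ler1n.
have -> : e + s *: (q - e) = s *: q + (1 - s) *: e.
  by apply/rowP => j; rewrite !mxE; ring.
rewrite bary_comb; last by ring.
by rewrite ltr_wpDr ?mulr_gt0 // mulr_ge0 // subr_ge0.
Qed.

(** The point [M y - x] scaled by [1 / (M - 1)] has nonnegative barycentric
    coordinates if and only if [M] is at least every ratio [x j / y j], and it is
    on the boundary when [M] is the largest of them. *)
Lemma simplex_exits x y i : D x -> D y -> x != y ->
  (forall j, bary x 0 j / bary y 0 j <= bary x 0 i / bary y 0 i) ->
  exists e, exits (D := D) x y (bary x 0 i / bary y 0 i) e.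
Proof.
move=> /D_bary x0 /D_bary y0 xy; set M := bary x 0 i / bary y 0 i => Mmax.
have xM j : bary x 0 j <= M * bary y 0 j by rewrite -ler_pdivrMr.
have M1 : 1 < M.
  rewrite ltNge; apply: contra xy => M1.
  have xley j : 0 <= bary y 0 j - bary x 0 j.
    by rewrite subr_ge0; apply: (le_trans (xM j)); rewrite ler_piMl // ltW.
  have /eqP : \sum_j (bary y 0 j - bary x 0 j) = 0.
    by rewrite big_split /= sumrN !(proj1 (baryK _)) subrr.
  rewrite psumr_eq0 // => /allP eq0; apply/eqP.
  rewrite -(proj2 (baryK x)) -(proj2 (baryK y)); apply: eq_bigr => j _.
  by have /= := eq0 j (mem_index_enum _); rewrite subr_eq0 => /eqP ->.
pose e := (M / (M - 1)) *: y + (- (M - 1)^-1) *: x.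
have eE j : bary e 0 j = (M * bary y 0 j - bary x 0 j) / (M - 1).
  rewrite bary_comb; first by field; lra.
  by field; lra.
exists e; split=> //; last by apply/rowP => j; rewrite !mxE; field; lra.
split.
  by apply: simplex_closure => j; rewrite eE divr_ge0 ?subr_ge0 // ltW.
move=> /D_bary/(_ i); rewrite eE /M divfK ?subrr ?mul0r ?ltxx //.
exact: lt0r_neq0.
Qed.

Definition log_coord x : osc_space R n :=
  \row_j (ln (bary x 0 (rshift 1 j)) - ln (bary x 0 (lshift n ord0))).

Lemma pad_log_coord x i :
  pad (log_coord x) i = ln (bary x 0 i) - ln (bary x 0 (lshift n ord0)).
Proof.
rewrite /pad -[i]splitK; case: (fintype.split i) => k /=.
  by rewrite row_mxEl mxE (ord1 k) subrr.
by rewrite row_mxEr mxE.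
Qed.

Lemma log_coord_isometry x y : D x -> D y ->
  `|log_coord x - log_coord y| = hilbert_dist D x y.
Proof.
move=> Dx Dy; have [->|xy] := eqVneq x y.
  by rewrite subrr normr0 /hilbert_dist eqxx.
have x0 := iffLR (D_bary x) Dx; have y0 := iffLR (D_bary y) Dy.
pose rho i := bary x 0 i / bary y 0 i.
have rho0 i : 0 < rho i by rewrite divr_gt0.
pose a := [arg max_(i > ord0 : 'I_(1 + n)) rho i]%O.
pose b := [arg min_(i < ord0 : 'I_(1 + n)) rho i]%O.
have ha i : rho i <= rho a by rewrite /a; case: arg_maxP => // k _; exact.
have hb i : rho b <= rho i by rewrite /b; case: arg_minP => // k _; exact.
have [e xe] := simplex_exits Dx Dy xy ha.
have [|i|e' ye] := @simplex_exits y x b Dy Dx; first by rewrite eq_sym.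
  by rewrite -[leLHS]invf_div -[leRHS]invf_div lef_pV2 ?posrE ?divr_gt0 //; exact: hb.
rewrite (hilbertE hD Dx Dy xe ye).
have padE i : pad (log_coord x - log_coord y) i = ln (rho i) - ln (rho (lshift n ord0)).
  rewrite -scaleN1r padD padZ !pad_log_coord !ln_div ?posrE //; ring.
have -> : `|log_coord x - log_coord y| = osc (log_coord x - log_coord y) by [].
rewrite (@osc_eq _ _ _ a b) => [|i|i]; rewrite !padE ?lerB // ?ler_ln ?posrE //.
rewrite lnM ?posrE ?rho0 ?divr_gt0 //.
rewrite -[bary y 0 b / _]invf_div lnV ?posrE ?rho0 // /rho; ring.
Qed.

Lemma log_coord_surj : log_coord @` D = [set: osc_space R n].
Proof.
apply/seteqP; split=> // u _.
pose W := \sum_i expR (pad u i).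
have W0 : 0 < W.
  rewrite /W (bigD1 ord0) //= ltr_wpDr ?expR_gt0 //.
  by apply: sumr_ge0 => i _; exact: expR_ge0.
pose b : 'rV[R]_(1 + n) := \row_i (expR (pad u i) / W).
have b1 : \sum_i b 0 i = 1.
  by under eq_bigr do rewrite mxE; rewrite -mulr_suml divff // gt_eqF.
have bE := bary_unique b1.
exists (\sum_i b 0 i *: p i).
  by apply/D_bary => i; rewrite bE mxE divr_gt0 ?expR_gt0.
apply/rowP => j; rewrite mxE bE !mxE !ln_div ?posrE ?expR_gt0 // !expRK.
by rewrite /pad row_mxEl row_mxEr mxE; ring.
Qed.

Lemma simplex_isometric : isometric_to_normed_space D.
Proof.
exists (osc_space R n), log_coord; split; first exact: log_coord_surj.
exact: log_coord_isometry.
Qed.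

End Barycentric.

Theorem theorem2 (R : realType) (n : nat) (hn : (1 <= n)%N)
    (D : set 'rV[R]_n) (hD : bounded_convex_domain D) :
  isometric_to_normed_space D <->
  exists S : set 'rV[R]_n, is_simplex S /\ D = S°.
Proof.
split=> [[V [f [fsurj fiso]]]|[S [[p indep ->] DE]]].
  by apply: (cones_simplex hD) => xi; exact: (extreme_cone hn hD fsurj fiso).
exact: (simplex_isometric indep hD DE).
Qed.
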